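(* Let $G$ be a graph that is well-separable with respect to a set $\mathcal P$ of robust principal $(k+1)$-profiles of $G$, where $k=\kappa(\mathcal P,G)$. Then $G$ has a tree-decomposition $(T,\mathcal V)$ such that (1) $(T,\mathcal V)$ distinguishes any two $k$-distinguishable robust profiles in $\mathcal P$; (2) $(T,\mathcal V)$ is canonical with respect to $\mathcal P$; (3) $(T,\mathcal V)$ is $k$-balanced.
   Context: A separation of a graph $G$ is an ordered pair $(A,B)$ of subsets of $V(G)$ with $A\cup B=V(G)$ and no edge between $A\setminus B$ and $B\setminus A$; its order is $|A\cap B|$. $(A,B)\le(C,D)$ means $A\subseteq C$, $D\subseteq B$. A profile is a set $P$ of separations with (P1) if $(C,D)\le(A,B)\in P$ then $(D,C)\notin P$, and (P2) if $(A,B),(C,D)\in P$ then $(B\cap D,A\cup C)\notin P$. $P$ is principal if for every family $((A_i,B_i))_{i\in I}$ in $P$ with all $A_i\cap B_i$ equal, $\bigcap_i(B_i\setminus A_i)\neq\emptyset$; it is an $\ell$-profile if all its separations have order $<\ell$ and for each separation $(A,B)$ of order $<\ell$, $(A,B)\in P$ or $(B,A)\in P$; robust if for every $(A,B)\in P$ and every separation $(C,D)$ of finite order, if $(B\cap C,A\cup D)$, $(B\cap D,A\cup C)$ both have order $<|A\cap B|$ then one of them is not in $P$. A separation distinguishes $P,P'$ if it lies in one and its reverse in the other; $P,P'$ are $k$-distinguishable if some separation of order at most $k$ distinguishes them. $\kappa(\mathcal P,G)$ is the minimum order of a separation distinguishing two members of $\mathcal P$. $\mathcal R(k,\mathcal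 P,G)$ is the set of separations of finite order at most $k$ distinguishing two members of $\mathcal P$. A component $C$ of $G-(A\cap B)$ is degenerated if $N(C)\subsetneq A\cap B$; $G$ is well-separable w.r.t. $\mathcal P$ if no $(A,B)\in\mathcal R(\kappa(\mathcal P,G),\mathcal P,G)$ has a degenerated component of $G-(A\cap B)$. For a tree-decomposition $(T,(V_s))$, an edge $e$ induces $(\bigcup_{s\in T_1}V_s,\bigcup_{s\in T_2}V_s)$ and its reverse ($T_1,T_2$ the components of $T-e$); the tree-decomposition distinguishes two profiles if some separation induced by an edge distinguishes them; it is $k$-balanced if all adhesion sets $V_s\cap V_{s'}$ ($ss'\in E(T)$) have size exactly $k$. It is canonical w.r.t. $\mathcal P$ if its construction commutes with isomorphisms: whenever $\varphi:G\to G'$ is an isomorphism mapping $\mathcal P$ onto $\mathcal P'$, $\varphi$ maps the tree-decomposition for $(G,\mathcal P)$ onto that for $(G',\mathcal P')$. *)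

(* Defs.v *)
From Stdlib Require Import List Relations Arith.
Set Implicit Arguments.

Record graph := Graph {
  vert : Type;
  adj : vert -> vert -> Prop;
  adj_sym : forall x y, adj x y -> adj y x;
  adj_irrefl : forall x, ~ adj x x }.

Definition has_size (V : Type) (S : V -> Prop) (n : nat) : Prop :=
  exists l : list V, NoDup l /\ length l = n /\ (forall x, S x <-> In x l).

Definition sep (V : Type) := ((V -> Prop) * (V -> Prop))%type.

Definition sep_cap (V : Type) (s : sep V) : V -> Prop :=
  fun v => fst s v /\ snd s v.
Definition sep_rev (V : Type) (s : sep V) : sep V := (snd s, fst s).

Definition is_sep (G : graph) (s : sep (vert G)) : Prop :=
  (forall v, fst s v \/ snd s v) /\
  (forall u v, fst s u -> ~ snd s u -> snd s v -> ~ fst s v -> ~ adj G u v).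

Definition ord_lt (V : Type) (s : sep V) (l : nat) : Prop :=
  exists n, has_size (sep_cap s) n /\ n < l.
Definition ord_le (V : Type) (s : sep V) (k : nat) : Prop :=
  exists n, has_size (sep_cap s) n /\ n <= k.
Definition fin_ord (V : Type) (s : sep V) : Prop :=
  exists n, has_size (sep_cap s) n.

Definition sep_le (V : Type) (s t : sep V) : Prop :=
  (forall v, fst s v -> fst t v) /\ (forall v, snd t v -> snd s v).

Definition sep_meetrev (V : Type) (s t : sep V) : sep V :=
  (fun v => snd s v /\ snd t v, fun v => fst s v \/ fst t v).

Definition is_profile (G : graph) (P : sep (vert G) -> Prop) : Prop :=
  (forall s, P s -> is_sep G s) /\
  (forall s t, sep_le t s -> P s -> ~ P (sep_rev t)) /\
  (forall s t, P s -> P t -> ~ P (sep_meetrev s t)).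

Definition is_principal (V : Type) (P : sep V -> Prop) : Prop :=
  forall (S : sep V -> Prop) (X : V -> Prop),
    (forall s, S s -> P s) ->
    (forall s, S s -> forall v, sep_cap s v <-> X v) ->
    exists v, forall s, S s -> snd s v /\ ~ fst s v.

Definition is_lprofile (G : graph) (l : nat) (P : sep (vert G) -> Prop) : Prop :=
  is_profile G P /\
  (forall s, P s -> ord_lt s l) /\
  (forall s, is_sep G s -> ord_lt s l -> P s \/ P (sep_rev s)).

(** robust; |A ∩ B| = n is finite for members of an l-profile *)
Definition is_robust (G : graph) (P : sep (vert G) -> Prop) : Prop :=
  forall s, P s -> forall t, is_sep G t -> fin_ord t ->
  forall n, has_size (sep_cap s) n ->
  let x := (fun v => snd s v /\ fst t v, fun v => fst s v \/ snd t v) in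
  let y := (fun v => snd s v /\ snd t v, fun v => fst s v \/ fst t v) in
  ord_lt x n -> ord_lt y n -> ~ P x \/ ~ P y.

Definition distinguishes (V : Type) (s : sep V) (P P' : sep V -> Prop) : Prop :=
  (P s /\ P' (sep_rev s)) \/ (P' s /\ P (sep_rev s)).

Definition k_distinguishable (G : graph) (k : nat) (P P' : sep (vert G) -> Prop) : Prop :=
  exists s, is_sep G s /\ ord_le s k /\ distinguishes s P P'.

Definition profset (G : graph) := (sep (vert G) -> Prop) -> Prop.

Definition is_kappa (G : graph) (PP : profset G) (k : nat) : Prop :=
  (exists s P P', is_sep G s /\ PP P /\ PP P' /\
      has_size (sep_cap s) k /\ distinguishes s P P') /\
  (forall s P P', is_sep G s -> PP P -> PP P' -> distinguishes s P P' ->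
      ~ ord_lt s k).

Definition in_R (G : graph) (k : nat) (PP : profset G) (s : sep (vert G)) : Prop :=
  is_sep G s /\ ord_le s k /\ exists P P', PP P /\ PP P' /\ distinguishes s P P'.

Definition reach_in (G : graph) (S : vert G -> Prop) : relation (vert G) :=
  clos_refl_trans (vert G) (fun x y => adj G x y /\ S x /\ S y).

Definition component_of (G : graph) (X C : vert G -> Prop) : Prop :=
  exists v, ~ X v /\ forall u, C u <-> (~ X u /\ reach_in G (fun w => ~ X w) v u).

Definition nbhd (G : graph) (C : vert G -> Prop) (x : vert G) : Prop :=
  ~ C x /\ exists c, C c /\ adj G x c.

Definition degenerated (G : graph) (X C : vert G -> Prop) : Prop :=
  component_of G X C /\
  (forall x, nbhd G C x -> X x) /\ (exists x, X x /\ ~ nbhd G C x).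

Definition well_separable (G : graph) (PP : profset G) : Prop :=
  forall k, @is_kappa G PP k -> forall s, @in_R G k PP s ->
  forall C, ~ degenerated G (sep_cap s) C.

Definition avoid_edge (T : Type) (E : T -> T -> Prop) (x y : T) : T -> T -> Prop :=
  fun a b => E a b /\ ~ (a = x /\ b = y) /\ ~ (a = y /\ b = x).

Definition is_tree (T : Type) (E : T -> T -> Prop) : Prop :=
  inhabited T /\ (forall x y, E x y -> E y x) /\ (forall x, ~ E x x) /\
  (forall x y, clos_refl_trans T E x y) /\
  (forall x y, E x y -> ~ clos_refl_trans T (avoid_edge E x y) x y).

Record tdec (G : graph) := TDec {
  tnode : Type;
  tadj : tnode -> tnode -> Prop;
  bag : tnode -> vert G -> Prop }.

Definition is_td (G : graph) (D : tdec G) : Prop :=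
  is_tree (tadj D) /\
  (forall v, exists s, bag D s v) /\
  (forall u v, adj G u v -> exists s, bag D s u /\ bag D s v) /\
  (forall v s t, bag D s v -> bag D t v ->
     clos_refl_trans (tnode D) (fun a b => tadj D a b /\ bag D a v /\ bag D b v) s t).

Definition tside (G : graph) (D : tdec G) (s t u : tnode D) : Prop :=
  clos_refl_trans (tnode D) (avoid_edge (@tadj G D) s t) s u.

Definition induced_sep (G : graph) (D : tdec G) (s t : tnode D) : sep (vert G) :=
  (fun v => exists u, tside D s t u /\ bag D u v,
   fun v => exists u, tside D t s u /\ bag D u v).

Definition td_distinguishes (G : graph) (D : tdec G) (P P' : sep (vert G) -> Prop) : Prop :=
  exists s t, tadj D s t /\ distinguishes (induced_sep D s t) P P'.

Definition k_balanced (G : graph) (D : tdec G) (k : nat) : Prop :=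
  forall s t, tadj D s t -> has_size (fun v => bag D s v /\ bag D t v) k.

Definition bij (A B : Type) (f : A -> B) : Prop :=
  exists g : B -> A, (forall x, g (f x) = x) /\ (forall y, f (g y) = y).

Definition is_iso (G G' : graph) (f : vert G -> vert G') : Prop :=
  bij f /\ forall x y, adj G x y <-> adj G' (f x) (f y).

(** f maps PP onto PP' : PP' = { f(P) | P in PP },
    where f(P) = { (f A, f B) | (A,B) in P } *)
Definition maps_profset (G G' : graph) (f : vert G -> vert G')
    (PP : profset G) (PP' : profset G') : Prop :=
  forall P', PP' P' <-> exists P, PP P /\
     forall s : sep (vert G'), P' s <-> P (fun v => fst s (f v), fun v => snd s (f v)).

Definition maps_td (G G' : graph) (f : vert G -> vert G') (D : tdec G) (D' : tdec G') : Prop :=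
  exists psi : tnode D -> tnode D', bij psi /\
    (forall a b, tadj D a b <-> tadj D' (psi a) (psi b)) /\
    (forall a v, bag D a v <-> bag D' (psi a) (f v)).

Definition thm_hyp (G : graph) (PP : profset G) (k : nat) : Prop :=
  (forall P, PP P -> is_lprofile G (S k) P /\ is_robust G P /\ is_principal P) /\
  @is_kappa G PP k /\ @well_separable G PP.

(* Main.v *)
(** A separator X of a separation distinguishing two profiles of PP has exactly k vertices
    and, by well-separability, every component of G - X attaches to all of X. For two such
    separators crossing is therefore symmetric (X meets two components of G - Z iff Z meets
    two components of G - X), and each is crossed by finitely many others only, because two
    given vertices are separated by finitely many of them. Keep, for each pair of profiles,
    the distinguishing separators crossed least often: as orders and crossing numbers are
    submodular on opposite corners, the kept separators are pairwise non-crossing. Between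
    two of them lie only finitely many others, so they are the separators of a tree whose
    remaining nodes are the regions they cut out. A principal profile lives in one component
    of G - X, so the links of the tree at X distinguish what X distinguishes. *)

Require Import Defs.
From Stdlib Require Import List Relations Arith Lia Permutation.
From Stdlib Require Import Classical ClassicalEpsilon FunctionalExtensionality.
From Stdlib Require Import PropExtensionality ProofIrrelevance.
Set Implicit Arguments.
Unset Strict Implicit.

Lemma set_ext (V : Type) (A B : V -> Prop) : (forall v, A v <-> B v) -> A = B.
Proof.
  intros H; apply functional_extensionality; intros v.
  apply propositional_extensionality, H.
Qed.

(** * Finite sets *)

Definition fin (A : Type) (Q : A -> Prop) : Prop :=
  exists l, forall a, Q a -> In a l.

(** Only an upper bound, since the list may contain other elements and repetitions: it is the
    measure of the inductions over separators lying between two sets. *)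
Definition bounded (A : Type) (Q : A -> Prop) (n : nat) : Prop :=
  exists l, length l <= n /\ forall a, Q a -> In a l.

Lemma fin_bounded (A : Type) (Q : A -> Prop) : fin Q -> exists n, bounded Q n.
Proof. intros [l Hl]; exists (length l), l; auto. Qed.

Lemma bounded_remove (A : Type) (Q Q' : A -> Prop) n a :
  bounded Q n -> Q a -> (forall b, Q' b -> Q b) -> ~ Q' a ->
  exists m, n = S m /\ bounded Q' m.
Proof.
  intros [l [Hn Hl]] Ha Hsub Hna.
  destruct (in_split _ _ (Hl a Ha)) as [l1 [l2 ->]].
  rewrite length_app in Hn; simpl in Hn.
  destruct n as [|m]; [lia|].
  exists m; split; [reflexivity|].
  exists (l1 ++ l2); split; [rewrite length_app; lia|].
  intros b Hb.
  specialize (Hl b (Hsub b Hb)).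
  apply in_app_or in Hl; apply in_or_app.
  destruct Hl as [Hl|[->|Hl]]; tauto.
Qed.

Lemma fin_union (A B : Type) (l : list A) (F : A -> B -> Prop) :
  (forall a, In a l -> fin (F a)) -> fin (fun b => exists a, In a l /\ F a b).
Proof.
  induction l as [|a l IH]; intros H.
  - exists nil; intros b [a [[] _]].
  - destruct (H a (or_introl eq_refl)) as [l1 H1].
    destruct IH as [l2 H2]; [intros a' Ha'; apply H; right; exact Ha'|].
    exists (l1 ++ l2); intros b [a' [[<-|Ha'] Hb]]; apply in_or_app; [left|right]; eauto.
Qed.

Lemma fin_incl (A : Type) (Q Q' : A -> Prop) :
  fin Q -> (forall a, Q' a -> Q a) -> fin Q'.
Proof. intros [l Hl] H; exists l; auto. Qed.

(** Sizes become sums of indicators over a common enumeration, so that inequalities between them can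
    be checked element by element. *)
Definition ind (A : Type) (Q : A -> Prop) (a : A) : nat :=
  if excluded_middle_informative (Q a) then 1 else 0.

Definition eq_dec_classical (A : Type) (a b : A) : {a = b} + {a <> b} :=
  excluded_middle_informative (a = b).

Lemma has_size_sum (A : Type) (Q : A -> Prop) n U :
  has_size Q n -> NoDup U -> (forall a, Q a -> In a U) ->
  n = list_sum (map (ind Q) U).
Proof.
  intros [l [Hl [<- HQ]]] HU Hsub.
  set (f := fun a => if excluded_middle_informative (Q a) then true else false).
  transitivity (length (filter f U)).
  - apply Permutation_length, NoDup_Permutation; auto using NoDup_filter.
    intros a; rewrite filter_In, <- HQ; unfold f.
    specialize (Hsub a).
    destruct (excluded_middle_informative (Q a)) as [Ha|Ha]; [tauto|].
    split; [tauto|intros [_ H]; discriminate H].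
  - unfold f; clear; induction U as [|a U IH]; [reflexivity|].
    simpl; unfold ind at 1; destruct (excluded_middle_informative (Q a)); simpl; lia.
Qed.

Lemma has_size_fin (A : Type) (Q : A -> Prop) n : has_size Q n -> fin Q.
Proof. intros [l [_ [_ H]]]; exists l; firstorder. Qed.

Lemma fin_has_size (A : Type) (Q : A -> Prop) : fin Q -> exists n, has_size Q n.
Proof.
  intros [l Hl].
  set (f := fun a => if excluded_middle_informative (Q a) then true else false).
  set (l' := filter f (nodup (@eq_dec_classical A) l)).
  exists (length l'), l'; repeat split.
  - apply NoDup_filter, NoDup_nodup.
  - intros Ha; apply filter_In; split; [apply nodup_In; auto|].
    unfold f; destruct (excluded_middle_informative (Q x)); tauto.
  - intros Ha; apply filter_In in Ha; destruct Ha as [_ Ha]; revert Ha.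
    unfold f; destruct (excluded_middle_informative (Q x)); [auto|discriminate].
Qed.

Lemma fin_common_enum (A : Type) (Q1 Q2 : A -> Prop) :
  fin Q1 -> fin Q2 -> exists U, NoDup U /\ forall a, Q1 a \/ Q2 a -> In a U.
Proof.
  intros [l1 H1] [l2 H2].
  exists (nodup (@eq_dec_classical A) (l1 ++ l2)); split; [apply NoDup_nodup|].
  intros a Ha; apply nodup_In, in_or_app; firstorder.
Qed.

(** The counting behind submodularity, used both for the orders and for the crossing numbers of
    opposite corners. *)
Lemma size_sum_le (A : Type) (P1 P2 Q1 Q2 : A -> Prop) p1 p2 q1 q2 :
  has_size P1 p1 -> has_size P2 p2 -> has_size Q1 q1 -> has_size Q2 q2 ->
  (forall a, P1 a \/ P2 a -> Q1 a \/ Q2 a) ->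
  (forall a, P1 a -> P2 a -> Q1 a /\ Q2 a) ->
  p1 + p2 <= q1 + q2 /\
  ((exists a, (Q1 a \/ Q2 a) /\ ~ P1 a /\ ~ P2 a) -> p1 + p2 < q1 + q2).
Proof.
  intros HP1 HP2 HQ1 HQ2 Hor Hand.
  destruct (fin_common_enum (has_size_fin HQ1) (has_size_fin HQ2)) as [U [HU HUQ]].
  rewrite (has_size_sum HP1 HU), (has_size_sum HP2 HU), (has_size_sum HQ1 HU),
    (has_size_sum HQ2 HU) by auto.
  assert (Hpt : forall a, ind P1 a + ind P2 a <= ind Q1 a + ind Q2 a).
  { intros a; specialize (Hor a); specialize (Hand a); unfold ind.
    repeat destruct excluded_middle_informative; try lia; tauto. }
  split.
  - clear - Hpt; induction U as [|a U IH]; simpl; [lia|]; specialize (Hpt a); lia.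
  - intros [a [HQ [Hn1 Hn2]]].
    assert (Ha : ind P1 a + ind P2 a < ind Q1 a + ind Q2 a).
    { unfold ind; repeat destruct excluded_middle_informative; try lia; tauto. }
    assert (HaU : In a U) by auto.
    assert (Hle : forall U, list_sum (map (ind P1) U) + list_sum (map (ind P2) U)
                         <= list_sum (map (ind Q1) U) + list_sum (map (ind Q2) U)).
    { clear - Hpt; intros U; induction U as [|b U IH]; simpl; [lia|].
      specialize (Hpt b); lia. }
    destruct (in_split _ _ HaU) as [U1 [U2 ->]].
    rewrite !map_app, !list_sum_app; simpl.
    generalize (Hle U1) (Hle U2); lia.
Qed.

Lemma has_size_unique (A : Type) (Q : A -> Prop) m n :
  has_size Q m -> has_size Q n -> m = n.
Proof.
  intros [l [Hl [<- HQ]]] [l' [Hl' [<- HQ']]].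
  apply Permutation_length, NoDup_Permutation; auto.
  intros a; rewrite <- HQ, <- HQ'; reflexivity.
Qed.

Lemma has_size_incl_eq (A : Type) (X Y : A -> Prop) n :
  has_size X n -> has_size Y n -> (forall a, X a -> Y a) -> X = Y.
Proof.
  intros [lx [Hx [Hlx HX]]] [ly [Hy [Hly HY]]] Hsub.
  apply set_ext; intros a; split; [apply Hsub|].
  rewrite HX, HY; apply NoDup_length_incl; [exact Hx|lia|].
  intros b; rewrite <- HX, <- HY; apply Hsub.
Qed.

Lemma has_size_remove (A : Type) (Q : A -> Prop) n a :
  has_size Q (S n) -> Q a -> has_size (fun b => Q b /\ b <> a) n.
Proof.
  intros [l [Hl [Hn HQ]]] Ha.
  destruct (in_split a l) as [l1 [l2 ->]]; [apply HQ, Ha|].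
  pose proof (NoDup_remove _ _ _ Hl) as [Hl' Hna].
  exists (l1 ++ l2); split; [exact Hl'|split].
  - rewrite length_app in *; simpl in Hn; lia.
  - intros b; rewrite HQ, !in_app_iff in *; simpl; split.
    + intros [[H|[H|H]] Hb]; try tauto; congruence.
    + intros H; split; [tauto|]; intros ->; apply Hna; tauto.
Qed.

(** * Separating vertex sets *)

Section Separators.
Variable G : graph.
Implicit Types X Y Z S : vert G -> Prop.

(** Reflexive also at vertices of [Z], where it relates nothing else; hence the separate conditions
    such as [~ Z u]. *)
Definition conn Z : relation (vert G) := reach_in G (fun w => ~ Z w).

Definition separates Z (u v : vert G) : Prop := ~ Z u /\ ~ Z v /\ ~ conn Z u v.

(** For a separator [S] this is crossing; nestedness is its negation. *)
Definition splits Z S : Prop := exists u v, S u /\ S v /\ separates Z u v.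

(** The shape in which well-separability is used: each component of [G - Z], given by a vertex [v],
    attaches to all of [Z]. *)
Definition full Z : Prop :=
  forall v x, ~ Z v -> Z x -> exists c, conn Z v c /\ ~ Z c /\ adj G x c.

Lemma conn_refl Z u : conn Z u u.
Proof. apply rt_refl. Qed.

Lemma conn_trans Z u v w : conn Z u v -> conn Z v w -> conn Z u w.
Proof. apply rt_trans. Qed.

Lemma conn_sym Z u v : conn Z u v -> conn Z v u.
Proof.
  induction 1 as [u v [H [Hu Hv]]|u|u v w _ IH1 _ IH2].
  - apply rt_step; auto using adj_sym.
  - apply rt_refl.
  - eapply rt_trans; eauto.
Qed.

Lemma conn_adj Z u v : adj G u v -> ~ Z u -> ~ Z v -> conn Z u v.
Proof. intros; apply rt_step; auto. Qed.

Lemma conn_out Z u v : conn Z u v -> ~ Z u -> ~ Z v.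
Proof. induction 1 as [u v [_ [_ H]]| |]; auto. Qed.

Lemma conn_avoid X Z u v :
  (forall w, conn Z u w -> ~ X w) -> conn Z u v -> conn X u v.
Proof.
  intros Hav H; apply clos_rt_rtn1 in H.
  induction H as [|y z [Hyz [Hy Hz]] Huy IH]; [apply conn_refl|].
  apply clos_rtn1_rt in Huy.
  apply conn_trans with y; [exact IH|apply conn_adj; auto].
  apply Hav; apply conn_trans with y; [exact Huy|apply conn_adj; auto].
Qed.

Lemma separates_sym Z u v : separates Z u v -> separates Z v u.
Proof. intros [Hu [Hv H]]; repeat split; auto using conn_sym. Qed.

Lemma unsplit_conn Z S u v :
  ~ splits Z S -> S u -> S v -> ~ Z u -> ~ Z v -> conn Z u v.
Proof.
  intros H Hu Hv Hzu Hzv; apply NNPP; intros Hn.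
  apply H; exists u, v; repeat split; auto.
Qed.

(* If X lies in one component of G - Z (plus Z), any other component of G - Z avoids X
   and, Z being full, it attaches all of Z \ X to a single component of G - X. *)
Lemma far_side X Z x u :
  full Z -> ~ splits Z X -> X x -> separates Z x u ->
  ~ X u /\ forall z, Z z -> ~ X z -> conn X u z.
Proof.
  intros HZ Hns Hx [Hzx [Hzu Hxu]].
  assert (Hav : forall w, conn Z u w -> ~ X w).
  { intros w Huw HXw; apply Hxu.
    apply conn_trans with w; [|apply conn_sym, Huw].
    apply unsplit_conn with X; auto.
    exact (conn_out Huw Hzu). }
  split; [apply Hav, conn_refl|].
  intros z Hz HXz; destruct (HZ u z Hzu Hz) as [c [Huc [Hzc Hadj]]].
  apply conn_trans with c; [apply conn_avoid with Z; auto|].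
  apply conn_adj; auto using adj_sym.
Qed.

(** If [X] lies in [Z], the two are equal by size. Otherwise some component of [G - Z] lies apart
    from a vertex of [X] outside [Z], and by [far_side] it ties all of [Z] outside [X] to one
    component of [G - X]. *)
Lemma unsplit_sym X Z n :
  has_size X n -> has_size Z n -> full Z -> (exists u v, separates Z u v) ->
  ~ splits Z X -> ~ splits X Z.
Proof.
  intros HsX HsZ HZ [p [q Hpq]] Hns.
  destruct (classic (forall x, X x -> Z x)) as [Hsub|Hsub].
  - rewrite (has_size_incl_eq HsX HsZ Hsub).
    intros [u [v [Hu [_ [Hnu _]]]]]; auto.
  - apply not_all_ex_not in Hsub; destruct Hsub as [x Hx].
    apply imply_to_and in Hx; destruct Hx as [Hx Hzx].
    assert (Hu : exists u, separates Z x u).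
    { destruct Hpq as [Hp [Hq Hpq]].
      destruct (classic (conn Z x p)) as [H|H].
      - exists q; repeat split; auto.
        intros Hxq; apply Hpq; eauto using conn_trans, conn_sym.
      - exists p; repeat split; auto. }
    destruct Hu as [u Hu].
    destruct (far_side HZ Hns Hx Hu) as [HXu Hfar].
    intros [z [z' [Hz [Hz' [Hnz [Hnz' Hsep]]]]]]; apply Hsep.
    apply conn_trans with u; [apply conn_sym|]; auto.
Qed.

(** * Finiteness of the full separators of two vertices *)

(** The list holds the vertices of a walk after [u]; a set separating its ends has to meet it. *)
Lemma conn_support Z u v :
  conn Z u v -> exists l, (forall w, In w l -> ~ Z w) /\
    forall X, separates X u v -> exists w, In w l /\ X w.
Proof.
  intros H; apply clos_rt_rt1n in H.
  induction H as [u|u w v [Huw [Hu Hw]] _ IH].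
  - exists nil; split; [intros w []|].
    intros X [_ [_ HX]]; destruct HX; apply conn_refl.
  - destruct IH as [l [Hl HX]]; exists (w :: l); split.
    + intros y [<-|Hy]; auto.
    + intros X Hsep; destruct (classic (X w)) as [HXw|HXw].
      * exists w; simpl; auto.
      * destruct Hsep as [HXu [HXv Hn]].
        destruct (HX X) as [y [Hy HXy]].
        -- repeat split; auto; intros Hc; apply Hn.
           apply conn_trans with w; [apply conn_adj|]; auto.
        -- exists y; simpl; auto.
Qed.

(* Induction on the number of vertices of Z outside Y: a u-v path avoiding Y has to meet Z,
   and adding the meeting vertex to Y makes progress. *)
Lemma finite_full_separators_above n : forall Y u v,
  fin (fun Z => full Z /\ separates Z u v /\ (forall y, Y y -> Z y) /\
                has_size (fun z => Z z /\ ~ Y z) n).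
Proof.
  induction n as [|n IH]; intros Y u v.
  - exists (Y :: nil); intros Z [_ [_ [Hsub [l [_ [Hl HZ]]]]]]; left.
    apply set_ext; intros z; split; [apply Hsub|].
    intros Hz; apply NNPP; intros Hy.
    destruct l; [exact (proj1 (HZ z) (conj Hz Hy))|discriminate].
  - destruct (classic (conn Y u v)) as [Huv|Huv].
    + destruct (conn_support Huv) as [l [HlY Hl]].
      eapply fin_incl; [apply fin_union with (l := l) (F := fun w Z =>
        full Z /\ separates Z u v /\ (forall y, Y y \/ y = w -> Z y) /\
        has_size (fun z => Z z /\ ~ (Y z \/ z = w)) n)|].
      * intros w _; apply IH.
      * intros Z [HZ [Hsep [Hsub Hn]]].
        destruct (Hl Z Hsep) as [w [Hw HZw]]; exists w; repeat split; auto; try apply Hsep.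
        -- intros y [Hy| ->]; auto.
        -- apply has_size_remove with (a := w) in Hn; [|auto].
           replace (fun z => Z z /\ ~ (Y z \/ z = w))
             with (fun z => (Z z /\ ~ Y z) /\ z <> w); [exact Hn|].
           apply set_ext; intros z; tauto.
    (* If [Y] already keeps [u] from [v], there is no such [Z]: by fullness the components of [u]
       and of [v] in [G - Z] both attach to a vertex [z] outside [Y], which joins them in
       [G - Y]. *)
    + exists nil; intros Z [HZ [[Hu [Hv Hsep]] [Hsub [l [_ [Hl HlZ]]]]]].
      destruct l as [|z l]; [discriminate|].
      destruct (proj2 (HlZ z) (or_introl eq_refl)) as [Hz Hyz].
      destruct (HZ u z Hu Hz) as [c [Huc [Hc Hzc]]].
      destruct (HZ v z Hv Hz) as [d [Hvd [Hd Hzd]]].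
      apply Huv.
      assert (Hmono : forall a b, conn Z a b -> ~ Z a -> conn Y a b).
      { intros a b Hab Ha; apply conn_avoid with Z; auto.
        intros w Haw Hw; apply (conn_out Haw); auto. }
      apply conn_trans with c; [auto|].
      apply conn_trans with z; [apply conn_adj; auto using adj_sym|].
      apply conn_trans with d; [apply conn_adj; auto|].
      apply conn_sym; auto.
Qed.

Lemma finite_full_separators n u v :
  fin (fun Z => full Z /\ separates Z u v /\ has_size Z n).
Proof.
  eapply fin_incl; [apply (finite_full_separators_above n (fun _ => False) u v)|].
  intros Z [HZ [Hsep Hn]]; repeat split; auto; try apply Hsep; [tauto|].
  replace (fun z => Z z /\ ~ False) with Z; [exact Hn|].
  apply set_ext; tauto.
Qed.

End Separators.

(** * The structure tree of a nested family of separators *)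

Section StructureTree.
Variable G : graph.
Variable N : (vert G -> Prop) -> Prop.
Implicit Types X Y Z S : vert G -> Prop.

(* The node next to X in the direction of the component of c in G - X. Nodes are plain
   vertex sets and links are inclusions, so an isomorphism acts on the tree by taking images. *)
Definition region X (c v : vert G) : Prop :=
  (X v \/ conn X c v) /\ forall Z x, N Z -> X x -> ~ separates Z x v.

Definition is_node (U : vert G -> Prop) : Prop :=
  N U \/ exists X c, N X /\ ~ X c /\ U = region X c.

(** Oriented from the separator to the region; [~ N U] makes the tree bipartite. *)
Definition hangs_on X (U : vert G -> Prop) : Prop :=
  N X /\ ~ N U /\ forall v, X v -> U v.

Definition structure_tree : tdec G :=
  TDec G (fun a b : {U | is_node U} =>
            hangs_on (proj1_sig a) (proj1_sig b) \/ hangs_on (proj1_sig b) (proj1_sig a))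
         (fun a => proj1_sig a).

Local Notation link := (tadj structure_tree).
Local Notation bagof := (bag structure_tree).
Implicit Types a b x w : tnode structure_tree.

Lemma node_eq a b : bagof a = bagof b -> a = b.
Proof.
  destruct a as [A HA], b as [B HB]; simpl; intros ->.
  f_equal; apply proof_irrelevance.
Qed.

(** For the link between [X] and its region at [c], this property of a bag tells on which side of
    the link its node lies. *)
Definition meets X c (U : vert G -> Prop) : Prop := exists u, U u /\ conn X c u.

Definition unsplit S : Prop := forall Z, N Z -> ~ splits Z S.

Definition between S1 S2 Z : Prop :=
  N Z /\ exists u v, S1 u /\ S2 v /\ separates Z u v.

Hypothesis N_unsplit : forall X, N X -> unsplit X.
Hypothesis N_antichain :
  forall X Y, N X -> N Y -> (forall v, X v -> Y v) -> X = Y.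
Hypothesis N_full : forall X, N X -> full X.
Hypothesis N_fin : forall X, N X -> fin X.
Hypothesis N_sep_fin : forall u v, fin (fun Z => N Z /\ separates Z u v).
Hypothesis N_inhabited : exists X, N X.

(** * Separators lying between two sets *)

Lemma between_sym S1 S2 Z : between S1 S2 Z -> between S2 S1 Z.
Proof.
  intros [HZ [u [v [Hu [Hv H]]]]]; split; [exact HZ|].
  exists v, u; auto using separates_sym.
Qed.

Lemma between_fin S1 S2 : fin S1 -> fin S2 -> fin (between S1 S2).
Proof.
  intros [l1 H1] [l2 H2].
  eapply fin_incl.
  - apply fin_union with (l := l1)
      (F := fun u Z => exists v, In v l2 /\ (N Z /\ separates Z u v)).
    intros u _; apply fin_union; intros v _; apply N_sep_fin.
  - intros Z [HZ [u [v [Hu [Hv H]]]]]; exists u; split; auto.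
    exists v; auto.
Qed.

Lemma not_incl_witness X Y : N X -> N Y -> X <> Y -> exists v, X v /\ ~ Y v.
Proof.
  intros HX HY Hne; apply NNPP; intros Hn; apply Hne.
  apply N_antichain; auto.
  intros v Hv; apply NNPP; intros Hv'; apply Hn; eauto.
Qed.

(** By [far_side], [Z'] outside [Z] lies with [S1] in [G - Z]; again by [far_side], [Z] outside [Z']
    then lies with [s] in [G - Z']. So what [Z'] separates from [z] it separates from [s]. Passing
    from [S2] to [Z] thus lowers the number of separators between. *)
Lemma between_incl S1 S2 Z Z' :
  unsplit S1 -> between S1 S2 Z -> between S1 Z Z' -> between S1 S2 Z'.
Proof.
  intros HS1 [HZ [x [s [Hx [Hs Hxs]]]]] [HZ' [x' [z [Hx' [Hz Hx'z]]]]].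
  split; [exact HZ'|]; exists x', s; split; [exact Hx'|]; split; [exact Hs|].
  destruct (not_incl_witness HZ' HZ) as [z' [Hz' HZz']].
  { intros ->; destruct Hx'z as [_ [H _]]; exact (H Hz). }
  destruct (far_side (N_full HZ') (N_unsplit HZ HZ') Hz (separates_sym Hx'z))
    as [HZx' Hfar'].
  assert (Hsz' : separates Z z' s).
  { destruct Hxs as [Hzx [Hzs Hxs]]; repeat split; auto.
    intros H; apply Hxs.
    apply conn_trans with x'; [apply unsplit_conn with S1; auto|].
    apply conn_trans with z'; auto. }
  destruct (far_side (N_full HZ) (N_unsplit HZ' HZ) Hz' Hsz') as [HZs Hfar].
  destruct Hx'z as [HZ'x' [HZ'z Hx'z]]; repeat split; auto.
  intros H; apply Hx'z; apply conn_trans with s; auto.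
Qed.

Lemma not_between_self S X : ~ between S X X.
Proof. intros [_ [u [v [_ [Hv [_ [H _]]]]]]]; auto. Qed.

(** * Regions and the links they form *)

Lemma unsplit_point c : unsplit (fun v => v = c).
Proof. intros Z _ [u [v [-> [-> [_ [_ H]]]]]]; apply H, conn_refl. Qed.

Lemma point_fin (c : vert G) : fin (fun v => v = c).
Proof. exists (c :: nil); intros v ->; left; reflexivity. Qed.

(** For [Z] other than [X], fix a vertex [x] of [X] outside [Z]: no vertex of the region is
    separated from [x], so those outside [Z] share the component of [x]. For [Z = X] they share that
    of [c]. *)
Lemma region_unsplit X c : N X -> unsplit (region X c).
Proof.
  intros HX Z HZ [u [v [[Hu Hu'] [[Hv Hv'] [Hzu [Hzv Huv]]]]]].
  destruct (classic (Z = X)) as [->|Hne].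
  - apply Huv; destruct Hu as [Hu|Hu]; [tauto|]; destruct Hv as [Hv|Hv]; [tauto|].
    apply conn_trans with c; auto using conn_sym.
  - destruct (not_incl_witness HX HZ) as [x [Hx Hzx]]; [congruence|].
    assert (H : forall y, region X c y -> ~ Z y -> conn Z x y).
    { intros y [_ Hy] Hzy; apply NNPP; intros H; apply (Hy Z x HZ Hx); repeat split; auto. }
    apply Huv; apply conn_trans with x; [apply conn_sym|]; apply H; unfold region; auto.
Qed.

Lemma node_unsplit a : unsplit (bagof a).
Proof.
  destruct a as [U [HU|[X [c [HX [Hc HU]]]]]]; simpl; [auto|].
  subst U; apply region_unsplit, HX.
Qed.

Lemma region_incl X c : N X -> forall v, X v -> region X c v.
Proof.
  intros HX v Hv; split; [auto|].
  intros Z x HZ Hx Hs; apply (N_unsplit HX HZ); exists x, v; auto.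
Qed.

Lemma region_conn X c c' : conn X c c' -> region X c = region X c'.
Proof.
  intros H; apply set_ext; intros v; unfold region.
  intuition eauto using conn_trans, conn_sym.
Qed.

Lemma unsplit_side X S u v :
  N X -> unsplit S -> S u -> S v -> ~ X u -> X v \/ conn X u v.
Proof.
  intros HX HS Hu Hv Hxu; destruct (classic (X v)); [auto|right].
  apply unsplit_conn with S; auto.
Qed.

(* If the separators between X and S can be exhausted, a nearest one supplies the vertex. *)
Lemma region_beyond n : forall X S s,
  N X -> unsplit S -> bounded (between X S) n -> S s -> ~ X s ->
  exists u, conn X s u /\ region X s u.
Proof.
  induction n as [n IH] using (well_founded_induction lt_wf).
  intros X S s HX HS Hn Hs Hxs.
  destruct (classic (exists Z, between X S Z)) as [[Z HZ]|Hno].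
  - destruct (bounded_remove (Q' := between X Z) Hn HZ) as [m [-> Hm]].
    { intros Z'; apply between_incl; auto. }
    { apply not_between_self. }
    destruct HZ as [HNZ [x [s0 [Hx [Hs0 Hsep]]]]].
    destruct (not_incl_witness HNZ HX) as [z [Hz Hxz]].
    { intros ->; destruct Hsep as [H _]; exact (H Hx). }
    destruct (far_side (N_full HNZ) (N_unsplit HX HNZ) Hx Hsep) as [Hxs0 Hfar].
    assert (Hsz : conn X s z).
    { apply conn_trans with s0; [apply unsplit_conn with S; auto|auto]. }
    destruct (IH m (Nat.lt_succ_diag_r m) X Z z) as [u [Hzu Hu]]; auto.
    exists u; split; [eauto using conn_trans|].
    rewrite (region_conn Hsz); exact Hu.
  - exists s; split; [apply conn_refl|]; split; [right; apply conn_refl|].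
    intros Z x HZ Hx Hsep; apply Hno; exists Z; split; [exact HZ|].
    exists x, s; auto.
Qed.

(** This keeps regions apart from separators and makes [meets X c] true at the region end of a
    link. *)
Lemma region_proper X c : N X -> ~ X c -> exists u, conn X c u /\ region X c u.
Proof.
  intros HX Hc.
  destruct (fin_bounded (between_fin (N_fin HX) (point_fin c))) as [n Hn].
  apply (region_beyond (n := n) (S := fun v => v = c)); auto using unsplit_point.
Qed.

Lemma region_not_N X c : N X -> ~ X c -> ~ N (region X c).
Proof.
  intros HX Hc HN.
  assert (H : X = region X c) by (apply N_antichain; auto using region_incl).
  destruct (region_proper HX Hc) as [u [Hcu Hu]].
  rewrite <- H in Hu; exact (conn_out Hcu Hc Hu).
Qed.

Lemma hangs_on_own_region X c : N X -> ~ X c -> hangs_on X (region X c).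
Proof. intros HX Hc; split; [exact HX|split; auto using region_not_N, region_incl]. Qed.

(** One node can be a region of many separators. If it arose from [X] and contains another separator
    [Y], then, being unsplit, it equals the region of [Y] at a vertex of [X] outside [Y]. Thus every
    link joins a separator to one of its own regions. *)
Lemma hangs_on_region Y a :
  hangs_on Y (bagof a) -> exists c, ~ Y c /\ bagof a = region Y c.
Proof.
  destruct a as [U HU]; simpl; intros [HY [HnU Hsub]].
  destruct HU as [HU|[X [c [HX [Hc ->]]]]]; [contradiction|].
  destruct (classic (X = Y)) as [<-|Hne]; [eauto|].
  destruct (not_incl_witness HX HY Hne) as [x [Hx Hyx]].
  destruct (not_incl_witness HY HX) as [y [Hy Hxy]]; [congruence|].
  exists x; split; [exact Hyx|].
  pose proof (region_unsplit (c := c) HX) as HU.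
  pose proof (region_unsplit (c := x) HY) as HW.
  assert (Hin : forall v, region X c v -> region Y x v).
  { intros v Hv; split.
    - apply unsplit_side with (region X c); auto using region_incl.
    - intros Z y' HZ Hy' Hs; apply (HU Z HZ); exists y', v; auto. }
  apply set_ext; intros v; split; [apply Hin|].
  intros Hv; split.
  - destruct (Hsub y Hy) as [[Hy'|Hcy] _]; [contradiction|].
    destruct (unsplit_side (u := y) (v := v) HX HW) as [H|H]; auto using region_incl.
    right; eauto using conn_trans.
  - intros Z x' HZ Hx' Hs; apply (HW Z HZ); exists x', v; auto using region_incl.
Qed.

(** * Connectedness of the structure tree *)

Definition sep_node X (HX : N X) : tnode structure_tree := exist _ X (or_introl HX).

Lemma link_sym a b : link a b -> link b a.
Proof. intros [H|H]; [right|left]; exact H. Qed.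

Local Notation reach := (clos_refl_trans (tnode structure_tree) link).

Lemma reach_sym a b : reach a b -> reach b a.
Proof.
  induction 1; [apply rt_step, link_sym; assumption|apply rt_refl|eapply rt_trans; eauto].
Qed.

Lemma sep_node_reach_superset X (HX : N X) b :
  (forall v, X v -> bagof b v) -> reach (sep_node HX) b.
Proof.
  intros Hb; destruct (classic (N (bagof b))) as [HNb|HNb].
  - replace b with (sep_node HX); [apply rt_refl|].
    apply node_eq; simpl; apply N_antichain; auto.
  - apply rt_step; left; split; [exact HX|split; assumption].
Qed.

(** A separator [Z] between [X] and [S] leaves fewer between [X] and [Z] and between [Z] and [S];
    the two paths are glued at the node of [Z]. If there is none, [S] fits into [X] or into one
    region of [X]. Applied with separators, single vertices and edges as [S]. *)
Lemma node_above n : forall X (HX : N X) S, unsplit S -> bounded (between X S) n ->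
  exists b, (forall s, S s -> bagof b s) /\ reach (sep_node HX) b.
Proof.
  induction n as [n IH] using (well_founded_induction lt_wf).
  intros X HX S HS Hn.
  destruct (classic (exists Z, between X S Z)) as [[Z HZ]|Hno].
  - destruct (bounded_remove (Q' := between X Z) Hn HZ) as [m [Hm Hb]].
    { intros Z'; apply between_incl; auto. }
    { apply not_between_self. }
    destruct (bounded_remove (Q' := between Z S) Hn HZ) as [m' [Hm' Hb']].
    { intros Z' HZ'; apply between_sym.
      apply between_incl with Z; auto using between_sym. }
    { intros H; exact (not_between_self (between_sym H)). }
    pose proof (proj1 HZ) as HNZ.
    destruct (IH m ltac:(lia) X HX Z (N_unsplit HNZ) Hb) as [b [Hzb Hxb]].
    destruct (IH m' ltac:(lia) Z HNZ S HS Hb') as [b' [Hsb Hzb']].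
    exists b'; split; [exact Hsb|].
    apply rt_trans with b; [exact Hxb|].
    apply rt_trans with (sep_node HNZ); [|exact Hzb'].
    apply reach_sym, sep_node_reach_superset, Hzb.
  - destruct (classic (forall s, S s -> X s)) as [Hsub|Hsub].
    + exists (sep_node HX); split; [exact Hsub|apply rt_refl].
    + apply not_all_ex_not in Hsub; destruct Hsub as [s Hs].
      apply imply_to_and in Hs; destruct Hs as [Hs Hxs].
      assert (HU : is_node (region X s)) by (right; eauto).
      exists (exist _ _ HU); split.
      * intros v Hv; split; [apply unsplit_side with S; auto|].
        intros Z x HZ Hx Hsep; apply Hno; exists Z; split; [exact HZ|].
        exists x, v; auto.
      * apply sep_node_reach_superset; simpl; auto using region_incl.
Qed.

Lemma sep_node_reach_above X (HX : N X) S : unsplit S -> fin S ->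
  exists b, (forall s, S s -> bagof b s) /\ reach (sep_node HX) b.
Proof.
  intros HS Hf.
  destruct (fin_bounded (between_fin (N_fin HX) Hf)) as [n Hn].
  eapply node_above; eauto.
Qed.

Lemma node_reaches_sep b : exists X (HX : N X), reach (sep_node HX) b.
Proof.
  assert (H : exists X, N X /\ forall v, X v -> bagof b v).
  { destruct b as [U [HU|[X [c [HX [Hc ->]]]]]]; simpl; eauto using region_incl. }
  destruct H as [X [HX H]]; exists X, HX; apply sep_node_reach_superset, H.
Qed.

Lemma sep_nodes_connected X Y (HX : N X) (HY : N Y) : reach (sep_node HX) (sep_node HY).
Proof.
  destruct (sep_node_reach_above HX (N_unsplit HY) (N_fin HY)) as [b [Hb Hr]].
  apply rt_trans with b; [exact Hr|].
  apply reach_sym, sep_node_reach_superset, Hb.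
Qed.

Lemma tree_connected a b : reach a b.
Proof.
  destruct (node_reaches_sep a) as [X [HX Ha]], (node_reaches_sep b) as [Y [HY Hb]].
  apply rt_trans with (sep_node HX); [apply reach_sym, Ha|].
  apply rt_trans with (sep_node HY); [apply sep_nodes_connected|exact Hb].
Qed.

(** * The two sides of a link and the separation it induces *)

(* Links other than the one between X and its region at c do not cross the component of c
   in G - X. *)
Lemma link_meets X c x w a b :
  bagof x = X -> bagof w = region X c -> N X -> ~ X c ->
  avoid_edge link x w a b -> (meets X c (bagof a) <-> meets X c (bagof b)).
Proof.
  intros Hx Hw HX Hc.
  assert (H : forall a b, hangs_on (bagof a) (bagof b) -> ~ (a = x /\ b = w) ->
                (meets X c (bagof a) <-> meets X c (bagof b))).
  { clear a b; intros a b Hab Hne.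
    pose proof Hab as [Ha [_ Hsub]].
    split; intros [u [Hu Hcu]]; [exists u; auto|].
    destruct (classic (bagof a = X)) as [Hax|Hax].
    - destruct Hne; split; [apply node_eq; congruence|].
      destruct (hangs_on_region Hab) as [c' [Hc' Hb]].
      apply node_eq; rewrite Hw, Hb, Hax; symmetry; apply region_conn.
      rewrite Hax in *; rewrite Hb in Hu; destruct Hu as [[Hu|Hu] _].
      + destruct (conn_out Hcu Hc Hu).
      + eauto using conn_trans, conn_sym.
    - destruct (not_incl_witness Ha HX Hax) as [y [Hy Hxy]].
      exists y; split; [exact Hy|].
      apply conn_trans with u; [exact Hcu|].
      apply unsplit_conn with (bagof b); auto; [apply node_unsplit, HX|].
      exact (conn_out Hcu Hc). }
  intros [[Hab|Hab] [H1 H2]]; [apply H|symmetry; apply H]; tauto.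
Qed.

Lemma avoid_reach_meets X c x w a b :
  bagof x = X -> bagof w = region X c -> N X -> ~ X c ->
  clos_refl_trans _ (avoid_edge link x w) a b ->
  (meets X c (bagof a) <-> meets X c (bagof b)).
Proof.
  intros Hx Hw HX Hc; induction 1; [eapply link_meets; eauto|tauto|tauto].
Qed.

Lemma sep_not_meets X c : ~ X c -> ~ meets X c X.
Proof. intros Hc [u [Hu Hcu]]; exact (conn_out Hcu Hc Hu). Qed.

Lemma region_meets X c : N X -> ~ X c -> meets X c (region X c).
Proof. intros HX Hc; destruct (region_proper HX Hc) as [u [H1 H2]]; exists u; auto. Qed.

Lemma avoid_edge_sym (x w a b : tnode structure_tree) :
  avoid_edge link x w a b -> avoid_edge link w x a b.
Proof. unfold avoid_edge; tauto. Qed.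

Lemma avoid_reach_swap (x w a b : tnode structure_tree) :
  clos_refl_trans _ (avoid_edge link x w) a b ->
  clos_refl_trans _ (avoid_edge link w x) a b.
Proof.
  induction 1; [apply rt_step, avoid_edge_sym; assumption|apply rt_refl|].
  eapply rt_trans; eauto.
Qed.

Lemma tside_cover x w b :
  tside structure_tree x w b \/ tside structure_tree w x b.
Proof.
  pose proof (tree_connected x b) as H; apply clos_rt_rtn1 in H.
  induction H as [|a b Hab _ IH]; [left; apply rt_refl|].
  destruct (classic (a = x /\ b = w)) as [[-> ->]|H1]; [right; apply rt_refl|].
  destruct (classic (a = w /\ b = x)) as [[-> ->]|H2]; [left; apply rt_refl|].
  assert (Hs : avoid_edge link x w a b) by (split; auto).
  destruct IH as [IH|IH]; [left|right]; eapply rt_trans; try exact IH;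
    apply rt_step; auto using avoid_edge_sym.
Qed.

(** [meets X c] is constant along all other links, false at [x] and true at [w]; as each node lies
    on one of the two sides, both implications become equivalences. *)
Lemma tside_region X c x w b :
  bagof x = X -> bagof w = region X c -> N X -> ~ X c ->
  (tside structure_tree w x b <-> meets X c (bagof b)) /\
  (tside structure_tree x w b <-> ~ meets X c (bagof b)).
Proof.
  intros Hx Hw HX Hc.
  assert (Hwx : tside structure_tree w x b -> meets X c (bagof b)).
  { intros H; apply (avoid_reach_meets (a := w) Hx Hw); auto.
    - apply avoid_reach_swap, H.
    - rewrite Hw; apply region_meets; auto. }
  assert (Hxw : tside structure_tree x w b -> ~ meets X c (bagof b)).
  { intros H Hb; apply (sep_not_meets Hc).
    rewrite <- Hx at 2; apply (avoid_reach_meets Hx Hw HX Hc H), Hb. }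
  destruct (@tside_cover x w b); tauto.
Qed.

Lemma node_containing S : unsplit S -> fin S -> exists b, forall s, S s -> bagof b s.
Proof.
  intros HS Hf; destruct N_inhabited as [X HX].
  destruct (sep_node_reach_above HX HS Hf) as [b [Hb _]]; eauto.
Qed.

Lemma vertex_in_bag v : exists b, bagof b v.
Proof.
  destruct (node_containing (@unsplit_point v) (point_fin v)) as [b Hb]; eauto.
Qed.

(** A bag is not split by [X], so once it meets the component of [c] it stays within that component
    and [X]. *)
Lemma induced_sep_region X c x w :
  bagof x = X -> bagof w = region X c -> N X -> ~ X c ->
  induced_sep structure_tree x w = (fun v => ~ conn X c v, fun v => X v \/ conn X c v).
Proof.
  intros Hx Hw HX Hc.
  unfold induced_sep; f_equal; apply set_ext; intros v; split.
  - intros [u [Hu Hv]] Hcv.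
    apply (tside_region u Hx Hw HX Hc) in Hu; apply Hu; exists v; auto.
  - intros Hcv; destruct (classic (X v)) as [HXv|HXv].
    + exists x; split; [apply rt_refl|rewrite Hx; exact HXv].
    + destruct (vertex_in_bag v) as [b Hb]; exists b; split; [|exact Hb].
      apply (tside_region b Hx Hw HX Hc); intros [u [Hu Hcu]]; apply Hcv.
      apply conn_trans with u; [exact Hcu|].
      apply unsplit_conn with (bagof b); auto; [apply node_unsplit, HX|].
      exact (conn_out Hcu Hc).
  - intros [u [Hu Hv]].
    apply (tside_region u Hx Hw HX Hc) in Hu; destruct Hu as [y [Hy Hcy]].
    destruct (unsplit_side HX (node_unsplit (a := u)) Hy Hv (conn_out Hcy Hc)); eauto using conn_trans.
  - intros [HXv|Hcv].
    + exists w; split; [apply rt_refl|rewrite Hw; apply region_incl; auto].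
    + destruct (vertex_in_bag v) as [b Hb]; exists b; split; [|exact Hb].
      apply (tside_region b Hx Hw HX Hc); exists v; auto.
Qed.

(** * Connectedness of the bags of a vertex and the tree-decomposition axioms *)

Inductive walk : nat -> tnode structure_tree -> tnode structure_tree -> Prop :=
| walk_nil a : walk 0 a a
| walk_cons n a b d : link a b -> walk n b d -> walk (S n) a d.

Lemma reach_walk a b : reach a b -> exists n, walk n a b.
Proof.
  intros H; apply clos_rt_rt1n in H; induction H as [a|a b d Hab _ [n IH]].
  - exists 0; constructor.
  - exists (S n); econstructor; eauto.
Qed.

(** Only the step from [x] to [w] leads into the component, so the walk passes [w], and its rest
    from there is shorter. *)
Lemma walk_enters X c x w n a b :
  bagof x = X -> bagof w = region X c -> N X -> ~ X c ->
  walk n a b -> ~ meets X c (bagof a) -> meets X c (bagof b) ->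
  exists m, m < n /\ walk m w b.
Proof.
  intros Hx Hw HX Hc; induction 1 as [a|n a b d Hab Hbd IH]; intros Ha Hb; [contradiction|].
  destruct (classic (meets X c (bagof b))) as [Hmb|Hmb].
  - exists n; split; [lia|].
    destruct (classic (a = x /\ b = w)) as [[_ <-]|H1]; [exact Hbd|].
    destruct (classic (a = w /\ b = x)) as [[-> ->]|H2].
    + destruct Ha; rewrite Hw; apply region_meets; auto.
    + destruct Ha; apply (link_meets Hx Hw HX Hc (conj Hab (conj H1 H2))), Hmb.
  - destruct (IH Hmb Hb) as [m [Hm Hwm]]; exists m; split; [lia|exact Hwm].
Qed.

(* A walk leaving the nodes containing v through a link (x,w) has to come back through it,
   so it can be shortened. *)
Lemma bags_connected v n : forall a b, walk n a b -> bagof a v -> bagof b v ->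
  clos_refl_trans _ (fun a b => link a b /\ bagof a v /\ bagof b v) a b.
Proof.
  induction n as [n IH] using (well_founded_induction lt_wf); intros a b Hw Ha Hb.
  destruct Hw as [a|n a b d Hab Hbd]; [apply rt_refl|].
  destruct (classic (bagof b v)) as [Hbv|Hbv].
  - apply rt_trans with b; [apply rt_step; auto|].
    apply (IH n); auto.
  - destruct Hab as [Hab|Hba]; [destruct Hbv; apply Hab, Ha|].
    destruct (hangs_on_region Hba) as [c [Hc Ha']].
    assert (HN : N (bagof b)) by apply Hba.
    assert (Hcv : conn (bagof b) c v).
    { pose proof Ha as Hav; rewrite Ha' in Hav; destruct Hav as [[H|H] _]; [contradiction|exact H]. }
    destruct (walk_enters (c := c) (x := b) (w := a) (n := n) (a := b) (b := d) eq_refl Ha' HN Hc)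
      as [m [Hm Hwm]]; auto.
    + apply sep_not_meets, Hc.
    + exists v; auto.
    + apply (IH m); auto.
Qed.

Lemma hangs_on_bridge x w :
  hangs_on (bagof x) (bagof w) -> ~ clos_refl_trans _ (avoid_edge link x w) x w.
Proof.
  intros Hxw Hr; destruct (hangs_on_region Hxw) as [c [Hc Hw]].
  assert (HN : N (bagof x)) by apply Hxw.
  apply (sep_not_meets Hc), (avoid_reach_meets eq_refl Hw HN Hc Hr).
  rewrite Hw; apply region_meets; auto.
Qed.

Lemma avoid_reach_sym (x w a b : tnode structure_tree) :
  clos_refl_trans _ (avoid_edge link x w) a b ->
  clos_refl_trans _ (avoid_edge link x w) b a.
Proof.
  induction 1 as [a b [H1 H2]| |]; [|apply rt_refl|eapply rt_trans; eauto].
  apply rt_step; split; [apply link_sym, H1|tauto].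
Qed.

Lemma structure_tree_is_tree : is_tree link.
Proof.
  split; [destruct N_inhabited as [X HX]; exact (inhabits (sep_node HX))|].
  split; [exact link_sym|].
  split; [intros a [H|H]; destruct H as [H1 [H2 _]]; contradiction|].
  split; [exact tree_connected|].
  intros x w [Hxw|Hwx] Hr; [exact (hangs_on_bridge Hxw Hr)|].
  exact (hangs_on_bridge Hwx (avoid_reach_swap (avoid_reach_sym Hr))).
Qed.

Lemma edge_unsplit u v : adj G u v -> unsplit (fun y => y = u \/ y = v).
Proof.
  intros Huv Z _ [p [q [Hp [Hq [HZp [HZq Hpq]]]]]]; apply Hpq.
  destruct Hp as [->| ->], Hq as [->| ->];
    auto using conn_refl, conn_adj, adj_sym.
Qed.

Lemma structure_tree_is_td : is_td structure_tree.
Proof.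
  split; [exact structure_tree_is_tree|].
  split; [exact vertex_in_bag|].
  split.
  - intros u v Huv.
    destruct (node_containing (edge_unsplit Huv)) as [b Hb].
    { exists (u :: v :: nil); intros w [->| ->]; simpl; auto. }
    exists b; auto.
  - intros v a b Ha Hb.
    destruct (reach_walk (tree_connected a b)) as [n Hn].
    apply bags_connected with n; auto.
Qed.

(** A link is an inclusion, so its adhesion set is its separator end. *)
Lemma structure_tree_balanced k : (forall X, N X -> has_size X k) -> k_balanced structure_tree k.
Proof.
  intros Hk.
  assert (H : forall A B C, hangs_on A B -> (forall v, C v <-> A v /\ B v) -> has_size C k).
  { intros A B C [HA [_ HAB]] HC; replace C with A; [auto|].
    apply set_ext; intros v; rewrite HC; split; [auto|tauto]. }
  intros a b [Hab|Hba]; [apply (H _ _ _ Hab)|apply (H _ _ _ Hba)]; simpl; tauto.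
Qed.

Lemma structure_tree_edge X c : N X -> ~ X c ->
  exists a b, link a b /\
    induced_sep structure_tree a b = (fun v => ~ conn X c v, fun v => X v \/ conn X c v).
Proof.
  intros HX Hc.
  assert (HU : is_node (region X c)) by (right; eauto).
  exists (sep_node HX), (exist _ _ HU); split.
  - left; apply hangs_on_own_region; auto.
  - apply induced_sep_region; auto.
Qed.

End StructureTree.

(** * Separators distinguishing profiles *)

(* No bound on the order of s is needed: within (k+1)-profiles it is at most k. *)
Definition sep_dist (V : Type) (P Q : sep V -> Prop) (X : V -> Prop) : Prop :=
  exists s, P s /\ Q (sep_rev s) /\ sep_cap s = X.

Definition relevant (G : graph) (PP : profset G) (X : vert G -> Prop) : Prop :=
  exists P Q, PP P /\ PP Q /\ sep_dist P Q X.

Definition crossers (G : graph) (PP : profset G) (X Z : vert G -> Prop) : Prop :=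
  relevant PP Z /\ splits Z X.

(* Vacuous for infinitely many crossers, which well-separability rules out. *)
Definition fewer_crossers (G : graph) (PP : profset G) (X Y : vert G -> Prop) : Prop :=
  forall m n, has_size (crossers PP X) m -> has_size (crossers PP Y) n -> m <= n.

(** Minimality is relative to one pair of profiles, and all minimisers are kept: selecting one would
    spoil canonicity. *)
Definition chosen (G : graph) (PP : profset G) (X : vert G -> Prop) : Prop :=
  exists P Q, PP P /\ PP Q /\ sep_dist P Q X /\
    forall Y, sep_dist P Q Y -> fewer_crossers PP X Y.

Lemma sep_rev_rev (V : Type) (s : sep V) : sep_rev (sep_rev s) = s.
Proof. destruct s; reflexivity. Qed.

Lemma sep_cap_rev (V : Type) (s : sep V) : sep_cap (sep_rev s) = sep_cap s.
Proof. apply set_ext; intros v; unfold sep_cap; simpl; tauto. Qed.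

Lemma sep_dist_sym (V : Type) (P Q : sep V -> Prop) X : sep_dist P Q X -> sep_dist Q P X.
Proof.
  intros [s [Hs [Hr <-]]]; exists (sep_rev s).
  rewrite sep_rev_rev, sep_cap_rev; auto.
Qed.

(** * Splitting by sets on one side of a separation *)

Section Separations.
Variable G : graph.
Implicit Types s t : sep (vert G).
Implicit Types X Y Z : vert G -> Prop.

Lemma is_sep_rev s : is_sep G s -> is_sep G (sep_rev s).
Proof.
  intros [H1 H2]; split; simpl; [intros v; specialize (H1 v); tauto|].
  intros u v Hu Hu' Hv Hv' Huv; apply (H2 v u); auto using adj_sym.
Qed.

Lemma is_sep_meetrev s t : is_sep G s -> is_sep G t -> is_sep G (sep_meetrev s t).
Proof.
  intros [Hs Hs'] [Ht Ht']; split; simpl.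
  - intros v; specialize (Hs v); specialize (Ht v); tauto.
  - intros u v [Hu1 Hu2] Hu3 Hv1 Hv2 Huv.
    apply adj_sym in Huv.
    specialize (Hs v); specialize (Ht v); specialize (Hs' v u); specialize (Ht' v u); tauto.
Qed.

Lemma sep_conn s u v : is_sep G s -> conn (sep_cap s) u v -> ~ fst s u -> ~ fst s v.
Proof.
  intros [H1 H2]; induction 1 as [u v [Huv [Hu Hv]]| |]; auto.
  intros Hsu Hsv; unfold sep_cap in *; apply adj_sym in Huv.
  specialize (H1 u); apply (H2 v u); tauto.
Qed.

(* Beyond s the set Z is absent, so a component there stays connected in G - Z and
   attaches every vertex of the separator outside Z. *)
Lemma conn_beyond s Z q x :
  is_sep G s -> full (sep_cap s) -> (forall z, Z z -> fst s z) ->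
  ~ fst s q -> sep_cap s x -> ~ Z x -> conn Z q x.
Proof.
  intros Hs Hfull HZ Hq Hx Hzx.
  assert (Hav : forall w, conn (sep_cap s) q w -> ~ Z w).
  { intros w Hw Hzw; apply (sep_conn Hs Hw Hq); auto. }
  destruct (Hfull q x) as [c [Hqc [Hc Hxc]]]; auto; [intros [H _]; auto|].
  apply conn_trans with c; [apply conn_avoid with (sep_cap s); auto|].
  apply conn_adj; auto using adj_sym.
Qed.

Lemma unsplit_one_side s Z :
  is_sep G s -> ~ splits (sep_cap s) Z ->
  (forall z, Z z -> fst s z) \/ (forall z, Z z -> snd s z).
Proof.
  intros Hs Hns.
  destruct (classic (forall z, Z z -> snd s z)) as [H|H]; [auto|left].
  apply not_all_ex_not in H; destruct H as [z Hz].
  apply imply_to_and in Hz; destruct Hz as [Hz Hnz].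
  intros z' Hz'; apply NNPP; intros Hnz'.
  apply is_sep_rev in Hs.
  assert (Hc : conn (sep_cap (sep_rev s)) z z').
  { rewrite sep_cap_rev; apply unsplit_conn with Z; auto; intros [H1 H2]; auto. }
  apply (sep_conn Hs Hc Hnz).
  destruct Hs as [Hs _]; specialize (Hs z'); simpl in *; tauto.
Qed.

(** Each vertex of [S] outside [Z] reaches [x] in [G - Z]: within the separator because [Z] does not
    split it, beyond it by [conn_beyond]. *)
Lemma beyond_unsplit s Z S x :
  is_sep G s -> full (sep_cap s) -> (forall z, Z z -> fst s z) ->
  sep_cap s x -> ~ Z x -> ~ splits Z (sep_cap s) ->
  (forall v, S v -> snd s v) -> ~ splits Z S.
Proof.
  intros Hs Hfull HZ Hx Hzx Hns HS.
  assert (H : forall v, S v -> ~ Z v -> conn Z v x).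
  { intros v Hv Hzv; destruct (classic (fst s v)) as [Hsv|Hsv].
    - apply unsplit_conn with (sep_cap s); auto; split; auto.
    - apply conn_beyond with s; auto. }
  intros [u [v [Hu [Hv [Hzu [Hzv Huv]]]]]]; apply Huv.
  apply conn_trans with x; [|apply conn_sym]; auto.
Qed.

(** The component of [q] beyond [s] joins all separator vertices outside [Z]. *)
Lemma beyond_unsplits_cap s Z q :
  is_sep G s -> full (sep_cap s) -> (forall z, Z z -> fst s z) -> ~ fst s q ->
  ~ splits Z (sep_cap s).
Proof.
  intros Hs Hfull HZ Hq [u [v [Hu [Hv [Hzu [Hzv Huv]]]]]]; apply Huv.
  apply conn_trans with q; [apply conn_sym|]; apply conn_beyond with s; auto.
Qed.

(* If Z separated some x of X from some y of Y, then y and with it all of Y would lie in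
   the component of G - X containing Z \ X. *)
Lemma crossing_union_unsplit X Y Z S :
  full Z -> ~ splits Z X -> ~ splits Z Y -> ~ splits X Z -> splits X Y ->
  (forall v, S v -> X v \/ Y v) -> ~ splits Z S.
Proof.
  intros HZ HZX HZY HXZ [y1 [y2 [Hy1 [Hy2 [Hn1 [Hn2 Hy12]]]]]] HS.
  assert (Hxy : forall x y, X x -> Y y -> ~ separates Z x y).
  { intros x y Hx Hy Hsep.
    destruct (far_side HZ HZX Hx Hsep) as [HXy Hfar].
    assert (H : forall y', Y y' -> ~ X y' -> conn X y y').
    { intros y' Hy' HXy'; destruct (classic (Z y')) as [Hz|Hz]; [auto|].
      destruct Hsep as [Hzx [Hzy Hsep]].
      assert (Hyy' : conn Z y y') by (apply unsplit_conn with Y; auto).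
      apply conn_avoid with Z; [|exact Hyy'].
      intros w Hyw HXw; apply Hsep.
      apply conn_trans with w; [|apply conn_sym, Hyw].
      apply unsplit_conn with X; auto; exact (conn_out Hyw Hzy). }
    apply Hy12, conn_trans with y; [apply conn_sym|]; auto. }
  intros [u [v [Hu [Hv Hsep]]]].
  destruct (HS u Hu) as [Hu'|Hu'], (HS v Hv) as [Hv'|Hv'].
  - apply HZX; exists u, v; auto.
  - exact (Hxy u v Hu' Hv' Hsep).
  - exact (Hxy v u Hv' Hu' (separates_sym Hsep)).
  - apply HZY; exists u, v; auto.
Qed.

End Separations.

(** * Size, fullness and finiteness of distinguishing separators *)

Section Profiles.
Variable G : graph.
Variable PP : profset G.
Variable k : nat.
Hypothesis HPP : thm_hyp PP k.
Implicit Types s t : sep (vert G).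
Implicit Types X Y Z : vert G -> Prop.
Implicit Types P Q R : sep (vert G) -> Prop.

Lemma profile_of P : PP P -> is_lprofile G (S k) P /\ is_principal P.
Proof. intros HP; apply HPP in HP; tauto. Qed.

Lemma member_sep P s : PP P -> P s -> is_sep G s.
Proof. intros HP Hs; destruct (profile_of HP) as [[[H _] _] _]; auto. Qed.

(** At most [k] as the order of a member of a [(k+1)]-profile, at least [k] by minimality of
    kappa. *)
Lemma dist_size P Q s : PP P -> PP Q -> P s -> Q (sep_rev s) -> has_size (sep_cap s) k.
Proof.
  intros HP HQ Hs Hr.
  destruct (profile_of HP) as [[_ [Hord _]] _].
  destruct (Hord s Hs) as [n [Hn Hlt]].
  replace k with n; [exact Hn|].
  destruct HPP as [_ [[_ Hmin] _]].
  destruct (Nat.lt_ge_cases n k) as [H|H]; [|lia].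
  destruct (Hmin s P Q); eauto using member_sep; [left; auto|exists n; auto].
Qed.

Lemma orient P s n :
  PP P -> is_sep G s -> has_size (sep_cap s) n -> n <= k -> P s \/ P (sep_rev s).
Proof.
  intros HP Hs Hn Hk; destruct (profile_of HP) as [[_ [_ H]] _].
  apply H; auto; exists n; split; [auto|lia].
Qed.

Lemma beyond_nonempty P s : PP P -> P s -> exists v, snd s v /\ ~ fst s v.
Proof.
  intros HP Hs; destruct (profile_of HP) as [_ Hpr].
  destruct (Hpr (fun t => t = s) (sep_cap s)) as [v Hv].
  - intros t ->; exact Hs.
  - intros t ->; tauto.
  - exists v; auto.
Qed.

(** A component of [G - X] not attached to some [x] in the separator [X] would be degenerated. *)
Lemma dist_full P Q s : PP P -> PP Q -> P s -> Q (sep_rev s) -> full (sep_cap s).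
Proof.
  intros HP HQ Hs Hr v x Hv Hx; apply NNPP; intros Hn.
  pose proof HPP as [_ [Hk Hws]].
  apply (Hws k Hk s) with (C := fun u => ~ sep_cap s u /\ conn (sep_cap s) v u).
  - split; [eauto using member_sep|split].
    + exists k; split; [exact (dist_size HP HQ Hs Hr)|apply le_n].
    + exists P, Q; split; [exact HP|split; [exact HQ|left; auto]].
  - split; [exists v; split; [exact Hv|intros u; apply iff_refl]|split].
    + intros y [Hy [c [[Hc Hvc] Hyc]]]; apply NNPP; intros Hny; apply Hy; split; auto.
      apply conn_trans with c; [exact Hvc|apply conn_adj; auto using adj_sym].
    + exists x; split; [exact Hx|].
      intros [_ [c [[Hc Hvc] Hxc]]]; apply Hn; exists c; auto.
Qed.

Lemma relevant_size X : relevant PP X -> has_size X k.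
Proof. intros [P [Q [HP [HQ [s [Hs [Hr <-]]]]]]]; exact (dist_size HP HQ Hs Hr). Qed.

Lemma relevant_full X : relevant PP X -> full X.
Proof. intros [P [Q [HP [HQ [s [Hs [Hr <-]]]]]]]; exact (dist_full HP HQ Hs Hr). Qed.

Lemma relevant_separates X : relevant PP X -> exists u v, separates X u v.
Proof.
  intros [P [Q [HP [HQ [s [Hs [Hr <-]]]]]]].
  destruct (beyond_nonempty HP Hs) as [u [Hu Hu']].
  destruct (beyond_nonempty HQ Hr) as [v [Hv Hv']].
  exists u, v; unfold separates, sep_cap at 1 2; repeat split; try tauto.
  intros Huv; apply (sep_conn (member_sep HP Hs) Huv Hu'), Hv.
Qed.

Lemma relevant_splits_sym X Z : relevant PP X -> relevant PP Z -> splits X Z -> splits Z X.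
Proof.
  intros HX HZ H; apply NNPP; intros Hn; revert H.
  eapply unsplit_sym; eauto using relevant_size, relevant_full, relevant_separates.
Qed.

Lemma relevant_separators_fin u v : fin (fun Z => relevant PP Z /\ separates Z u v).
Proof.
  eapply fin_incl; [apply (finite_full_separators k u v)|].
  intros Z [HZ Hsep]; auto using relevant_full, relevant_size.
Qed.

(** A crosser separates two of the finitely many vertices of [X], and each such pair has finitely
    many relevant separators. *)
Lemma crossers_fin X : relevant PP X -> fin (crossers PP X).
Proof.
  intros HX; destruct (has_size_fin (relevant_size HX)) as [l Hl].
  eapply fin_incl.
  - apply fin_union with (l := l)
      (F := fun u Z => exists v, In v l /\ (relevant PP Z /\ separates Z u v)).
    intros u _; apply fin_union; intros v _; apply relevant_separators_fin.
  - intros Z [HZ [u [v [Hu [Hv H]]]]]; exists u; split; [auto|exists v; auto].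
Qed.

(** * Corners of two crossing separations *)

(** (P2) forbids the other orientation of the corner. *)
Lemma beyond_corner s t R n :
  is_sep G s -> is_sep G t -> has_size (sep_cap (sep_meetrev s t)) n -> n <= k ->
  PP R -> R s -> R t -> R (sep_rev (sep_meetrev s t)).
Proof.
  intros Hs Ht Hn Hk HR HRs HRt.
  destruct (profile_of HR) as [[[_ [_ HP2]] _] _].
  destruct (orient HR (is_sep_meetrev Hs Ht) Hn Hk) as [H|H]; [|exact H].
  destruct (HP2 s t HRs HRt H).
Qed.

(** The corner lies below the reverse of [s] and that of [t], so (P1) forbids its other
    orientation. *)
Lemma before_corner s t R n :
  is_sep G s -> is_sep G t -> has_size (sep_cap (sep_meetrev s t)) n -> n <= k ->
  PP R -> R (sep_rev s) \/ R (sep_rev t) -> R (sep_meetrev s t).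
Proof.
  intros Hs Ht Hn Hk HR HRst; destruct (profile_of HR) as [[[_ [HP1 _]] _] _].
  destruct (orient HR (is_sep_meetrev Hs Ht) Hn Hk) as [H|H]; [exact H|exfalso; revert H].
  destruct HRst as [H|H]; eapply HP1; try exact H; split; simpl; tauto.
Qed.

(* The orders of opposite corners add up to at most 2k; a corner of order at most k
   distinguishes R1 from R2, hence has order exactly k, and so has the other one. *)
Lemma corner_sizes s t R1 R2 :
  has_size (sep_cap s) k -> has_size (sep_cap t) k ->
  PP R1 -> PP R2 -> R1 s -> R1 t -> R2 (sep_rev s) -> R2 (sep_rev t) ->
  has_size (sep_cap (sep_meetrev s t)) k /\
  has_size (sep_cap (sep_meetrev (sep_rev s) (sep_rev t))) k.
Proof.
  intros Hks Hkt HR1 HR2 H1s H1t H2s H2t.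
  assert (Hs : is_sep G s) by eauto using member_sep.
  assert (Ht : is_sep G t) by eauto using member_sep.
  set (m := sep_meetrev s t); set (l := sep_meetrev (sep_rev s) (sep_rev t)).
  assert (Hfin : fin (fun v => sep_cap s v \/ sep_cap t v)).
  { destruct Hks as [ls [_ [_ Hls]]], Hkt as [lt [_ [_ Hlt]]].
    exists (ls ++ lt); intros v Hv; apply in_or_app; rewrite <- Hls, <- Hlt; exact Hv. }
  destruct (@fin_has_size _ (sep_cap m)) as [p Hp].
  { apply (fin_incl Hfin); unfold sep_cap; simpl; tauto. }
  destruct (@fin_has_size _ (sep_cap l)) as [q Hq].
  { apply (fin_incl Hfin); unfold sep_cap; simpl; tauto. }
  assert (Hsum : p + q <= k + k).
  { apply (size_sum_le Hp Hq Hks Hkt); unfold sep_cap; simpl; tauto. }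
  assert (Hpk : p <= k -> p = k).
  { intros H; pose proof (dist_size HR2 HR1 (before_corner Hs Ht Hp H HR2 (or_introl H2s))
      (beyond_corner Hs Ht Hp H HR1 H1s H1t)) as H3.
    exact (has_size_unique Hp H3). }
  assert (Hqk : q <= k -> q = k).
  { intros H; assert (H1 : R1 (sep_rev (sep_rev s)) \/ R1 (sep_rev (sep_rev t))).
    { rewrite !sep_rev_rev; auto. }
    pose proof (is_sep_rev Hs) as Hs'; pose proof (is_sep_rev Ht) as Ht'.
    pose proof (dist_size HR1 HR2 (before_corner Hs' Ht' Hq H HR1 H1)
      (beyond_corner Hs' Ht' Hq H HR2 H2s H2t)) as H3.
    exact (has_size_unique Hq H3). }
  assert (p = k /\ q = k) as [-> ->] by lia; auto.
Qed.

(* A set crossing a corner crosses one of the two given separators, a set crossing both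
   corners crosses both, and the separator of s crosses that of t but no corner. *)
Lemma corner_crossers s t M L m l x y :
  is_sep G s -> is_sep G t ->
  relevant PP (sep_cap s) -> relevant PP (sep_cap t) -> relevant PP M -> relevant PP L ->
  (exists v, ~ fst s v) -> (exists v, ~ snd s v) ->
  (exists v, ~ fst t v) -> (exists v, ~ snd t v) ->
  (forall v, M v -> sep_cap s v \/ sep_cap t v) ->
  (forall v, L v -> sep_cap s v \/ sep_cap t v) ->
  (forall v, M v -> snd s v /\ snd t v) -> (forall v, L v -> fst s v /\ fst t v) ->
  splits (sep_cap s) (sep_cap t) ->
  has_size (crossers PP M) m -> has_size (crossers PP L) l ->
  has_size (crossers PP (sep_cap s)) x -> has_size (crossers PP (sep_cap t)) y ->
  m + l < x + y.
Proof.
  intros Hs Ht HX HY HM HL Hs1 Hs2 Ht1 Ht2 HMu HLu HMside HLside Hcross Hm Hl Hx Hy.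
  (* Stated for one separation with [M] and [L] on its two sides, so that it serves for [s] and for
     [t]. *)
  assert (Hcap : forall s M L, is_sep G s -> relevant PP (sep_cap s) ->
    relevant PP M -> relevant PP L -> (exists v, ~ fst s v) -> (exists v, ~ snd s v) ->
    (forall v, M v -> snd s v) -> (forall v, L v -> fst s v) ->
    ~ splits (sep_cap s) L /\ ~ splits (sep_cap s) M /\
    forall Z, relevant PP Z -> splits Z M -> splits Z L -> splits Z (sep_cap s)).
  { clear - HPP; intros s M L Hs HX HM HL [q1 Hq1] [q2 Hq2] HMs HLs.
    assert (HXL : ~ splits (sep_cap s) L).
    { intros H; apply relevant_splits_sym in H; auto.
      revert H; apply beyond_unsplits_cap with q1; auto using relevant_full. }
    assert (HXM : ~ splits (sep_cap s) M).
    { intros H; apply relevant_splits_sym in H; auto.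
      rewrite <- sep_cap_rev in H.
      revert H; apply beyond_unsplits_cap with q2; auto using is_sep_rev.
      rewrite sep_cap_rev; auto using relevant_full. }
    split; [exact HXL|split; [exact HXM|]].
    intros Z HZ HZM HZL; apply NNPP; intros HZX.
    assert (HXZ : ~ splits (sep_cap s) Z) by (intros H; apply HZX, relevant_splits_sym; auto).
    (* Otherwise [Z] would equal the separator of [s] by size, which does not split [L]. *)
    assert (Hx : exists x, sep_cap s x /\ ~ Z x).
    { apply NNPP; intros Hn; apply HXL.
      replace (sep_cap s) with Z; [exact HZL|symmetry].
      apply has_size_incl_eq with k; auto using relevant_size.
      intros a Ha; apply NNPP; intros Hna; apply Hn; eauto. }
    destruct Hx as [x [Hx Hzx]].
    (* [Z] stays on one side of [s], so it cannot split the corner on the other side. *)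
    destruct (unsplit_one_side Hs HXZ) as [H|H].
    - revert HZM; apply beyond_unsplit with s x; auto using relevant_full.
    - revert HZL; apply beyond_unsplit with (sep_rev s) x; auto using is_sep_rev;
        rewrite sep_cap_rev; auto using relevant_full. }
  destruct (Hcap s M L) as [HsL [HsM Hs3]]; auto; try (intros; apply HMside || apply HLside; auto).
  destruct (Hcap t M L) as [HtL [HtM Ht3]]; auto; try (intros; apply HMside || apply HLside; auto).
  apply (size_sum_le Hm Hl Hx Hy).
  - assert (H : forall Z S, relevant PP Z -> splits Z S ->
      (forall v, S v -> sep_cap s v \/ sep_cap t v) ->
      splits Z (sep_cap s) \/ splits Z (sep_cap t)).
    { intros Z S HZ HZS HS; apply NNPP; intros Hn; revert HZS.
      apply crossing_union_unsplit with (sep_cap s) (sep_cap t); auto using relevant_full.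
      intros H; apply Hn; left; apply relevant_splits_sym; auto. }
    intros Z [[HZ HZS]|[HZ HZS]]; [destruct (H Z M HZ HZS HMu)|destruct (H Z L HZ HZS HLu)];
      unfold crossers; auto.
  - intros Z [HZ HZM] [_ HZL]; split; split; auto.
  - exists (sep_cap s); split; [right; split; auto|].
    split; intros [_ H]; auto.
Qed.

(** Hides the separators, so that nestedness of chosen ones becomes arithmetic with crossing
    numbers. *)
Definition dist_crossers P Q n : Prop :=
  exists M, sep_dist P Q M /\ has_size (crossers PP M) n.

(** The corner towards [R1] distinguishes [R1] from every profile containing the reverse of [s] or
    of [t]; the opposite corner distinguishes [R2] from every profile containing [s] or [t]. *)
Lemma corner_pair s t x y :
  relevant PP (sep_cap s) -> relevant PP (sep_cap t) -> splits (sep_cap s) (sep_cap t) ->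
  has_size (crossers PP (sep_cap s)) x -> has_size (crossers PP (sep_cap t)) y ->
  forall R1 R2, PP R1 -> PP R2 -> R1 s -> R1 t -> R2 (sep_rev s) -> R2 (sep_rev t) ->
  exists m l, m + l < x + y /\
    (forall R, PP R -> R (sep_rev s) \/ R (sep_rev t) -> dist_crossers R1 R m) /\
    (forall R, PP R -> R s \/ R t -> dist_crossers R2 R l).
Proof.
  intros HX HY Hcross Hx Hy R1 R2 HR1 HR2 H1s H1t H2s H2t.
  assert (Hs : is_sep G s) by eauto using member_sep.
  assert (Ht : is_sep G t) by eauto using member_sep.
  destruct (corner_sizes (relevant_size HX) (relevant_size HY) HR1 HR2 H1s H1t H2s H2t)
    as [HkM HkL].
  set (M := sep_cap (sep_meetrev s t)) in *.
  set (L := sep_cap (sep_meetrev (sep_rev s) (sep_rev t))) in *.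
  assert (HM : forall R, PP R -> R (sep_rev s) \/ R (sep_rev t) -> sep_dist R1 R M).
  { intros R HR H; apply sep_dist_sym; exists (sep_meetrev s t).
    split; [exact (before_corner Hs Ht HkM (le_n k) HR H)|].
    split; [exact (beyond_corner Hs Ht HkM (le_n k) HR1 H1s H1t)|reflexivity]. }
  assert (HL : forall R, PP R -> R s \/ R t -> sep_dist R2 R L).
  { intros R HR H; apply sep_dist_sym; exists (sep_meetrev (sep_rev s) (sep_rev t)).
    assert (H' : R (sep_rev (sep_rev s)) \/ R (sep_rev (sep_rev t))).
    { rewrite !sep_rev_rev; exact H. }
    pose proof (is_sep_rev Hs) as Hs'; pose proof (is_sep_rev Ht) as Ht'.
    split; [exact (before_corner Hs' Ht' HkL (le_n k) HR H')|].
    split; [exact (beyond_corner Hs' Ht' HkL (le_n k) HR2 H2s H2t)|reflexivity]. }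
  assert (HMr : relevant PP M) by (exists R1, R2; auto).
  assert (HLr : relevant PP L) by (exists R2, R1; auto).
  destruct (fin_has_size (crossers_fin HMr)) as [m Hm].
  destruct (fin_has_size (crossers_fin HLr)) as [l Hl].
  exists m, l; split; [|split; [exists M|exists L]; auto].
  destruct (beyond_nonempty HR1 H1s) as [b1 [_ Hb1]], (beyond_nonempty HR1 H1t) as [b2 [_ Hb2]].
  destruct (beyond_nonempty HR2 H2s) as [b3 [_ Hb3]], (beyond_nonempty HR2 H2t) as [b4 [_ Hb4]].
  apply (@corner_crossers s t M L); eauto; unfold M, L, sep_cap; simpl; tauto.
Qed.

(** * Existence and nestedness of chosen separators *)

Lemma dist_crossers_sym P Q n : dist_crossers P Q n -> dist_crossers Q P n.
Proof. intros [M [HM Hn]]; exists M; auto using sep_dist_sym. Qed.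

Lemma chosen_relevant X : chosen PP X -> relevant PP X.
Proof. intros [P [Q [HP [HQ [H _]]]]]; exists P, Q; auto. Qed.

Lemma exists_chosen P Q X0 :
  PP P -> PP Q -> sep_dist P Q X0 -> exists X, sep_dist P Q X /\ chosen PP X.
Proof.
  intros HP HQ H0.
  assert (Hne : exists n, dist_crossers P Q n).
  { destruct (@fin_has_size _ (crossers PP X0)) as [n Hn].
    - apply crossers_fin; exists P, Q; auto.
    - exists n, X0; auto. }
  destruct (dec_inh_nat_subset_has_unique_least_element (dist_crossers P Q)
              (fun n => classic _) Hne) as [x [[[X [HX Hx]] Hmin] _]].
  exists X; split; [exact HX|].
  exists P, Q; repeat split; auto.
  intros Y HY m n Hm Hn.
  rewrite (has_size_unique Hm Hx); apply Hmin; exists Y; auto.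
Qed.

(** Feeds the corners at [R1] and [R2] into each minimality hypothesis whose first profile owns the
    corner and whose second lies outside it; [revert] makes the loop end. *)
Ltac corner C R1 R2 :=
  let H := fresh "H" in let HM := fresh "HM" in let HL := fresh "HL" in
  destruct (C R1 R2) as [? [? [H [HM HL]]]]; [assumption..|];
  repeat match goal with
  | h : forall n, dist_crossers _ ?R n -> _ |- _ =>
      try pose proof (h _ (HM R ltac:(assumption) ltac:(tauto)));
      try pose proof (h _ (HL R ltac:(assumption) ltac:(tauto)));
      revert h
  end;
  intros.

(* P, Q, P', Q' each lie in one of the four corners of s and t. Two of them lie in opposite
   corners, and in nearly all cases these corners separate P from Q and P' from Q'
   respectively, with too few crossings in total. In the remaining case both pairs are in
   opposite corners, and comparing crossings gives x < y and y < x. *)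
Lemma chosen_unsplit X Y : chosen PP X -> chosen PP Y -> ~ splits X Y.
Proof.
  intros HX HY Hcross.
  pose proof (chosen_relevant HX) as HXr; pose proof (chosen_relevant HY) as HYr.
  destruct (fin_has_size (crossers_fin HXr)) as [x Hx].
  destruct (fin_has_size (crossers_fin HYr)) as [y Hy].
  destruct HX as [P [Q [HP [HQ [[s [HPs [HQs HXs]]] HminX]]]]].
  destruct HY as [P' [Q' [HP' [HQ' [[t [HPt [HQt HYt]]] HminY]]]]].
  assert (hPQ : forall n, dist_crossers P Q n -> x <= n).
  { intros n [M [HM Hn]]; exact (HminX M HM x n Hx Hn). }
  assert (hQP : forall n, dist_crossers Q P n -> x <= n) by auto using dist_crossers_sym.
  assert (hPQ' : forall n, dist_crossers P' Q' n -> y <= n).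
  { intros n [M [HM Hn]]; exact (HminY M HM y n Hy Hn). }
  assert (hQP' : forall n, dist_crossers Q' P' n -> y <= n) by auto using dist_crossers_sym.
  clear HminX HminY; subst X Y.
  assert (Hs : is_sep G s) by eauto using member_sep.
  assert (Ht : is_sep G t) by eauto using member_sep.
  pose proof (corner_pair HXr HYr Hcross Hx Hy) as Cst.
  (* [Cst] covers one diagonal pair of corners; reversing [t] gives the other. *)
  assert (Cst' := @corner_pair s (sep_rev t) x y).
  rewrite sep_cap_rev, sep_rev_rev in Cst'.
  specialize (Cst' HXr HYr Hcross Hx Hy).
  pose proof (orient HP Ht (relevant_size HYr) (le_n k)) as OP.
  pose proof (orient HQ Ht (relevant_size HYr) (le_n k)) as OQ.
  pose proof (orient HP' Hs (relevant_size HXr) (le_n k)) as OP'.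
  pose proof (orient HQ' Hs (relevant_size HXr) (le_n k)) as OQ'.
  clear HXr HYr Hcross Hx Hy Hs Ht.
  destruct OP, OQ, OP', OQ'; solve
    [ corner Cst P Q'; lia
    | corner Cst P' Q; lia
    | corner Cst' P P'; lia
    | corner Cst' Q' Q; lia
    | corner Cst P Q; corner Cst' Q' P'; lia
    | corner Cst' P Q; corner Cst P' Q'; lia ].
Qed.

Lemma chosen_antichain X Y :
  chosen PP X -> chosen PP Y -> (forall v, X v -> Y v) -> X = Y.
Proof.
  intros HX HY; apply has_size_incl_eq with k; auto using relevant_size, chosen_relevant.
Qed.

Lemma chosen_separators_fin u v : fin (fun Z => chosen PP Z /\ separates Z u v).
Proof.
  eapply fin_incl; [apply (relevant_separators_fin u v)|].
  intros Z [HZ H]; auto using chosen_relevant.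
Qed.

Lemma chosen_inhabited : exists X, chosen PP X.
Proof.
  destruct HPP as [_ [[[s [P [Q [_ [HP [HQ [_ Hd]]]]]]] _] _]].
  destruct Hd as [[H1 H2]|[H1 H2]];
    [destruct (exists_chosen (P := P) (Q := Q) (X0 := sep_cap s)) as [X [_ HX]]
    |destruct (exists_chosen (P := Q) (Q := P) (X0 := sep_cap s)) as [X [_ HX]]];
    eauto; exists s; auto.
Qed.

Lemma chosen_tree_is_td : is_td (structure_tree (chosen PP)).
Proof.
  apply structure_tree_is_td.
  - intros X HX Y HY; apply chosen_unsplit; auto.
  - exact chosen_antichain.
  - auto using relevant_full, chosen_relevant.
  - intros X HX; exact (has_size_fin (relevant_size (chosen_relevant HX))).
  - exact chosen_separators_fin.
  - exact chosen_inhabited.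
Qed.

(** * From chosen separators to distinguishing tree edges *)

Lemma component_sep_is_sep X c :
  ~ X c -> is_sep G (fun v => ~ conn X c v, fun v => X v \/ conn X c v).
Proof.
  intros Hc; split; simpl.
  - intros v; tauto.
  - intros u v Hu Hu' _ Hv Huv; apply NNPP in Hv; apply Hu.
    apply conn_trans with v; [exact Hv|].
    apply conn_adj; auto using adj_sym; exact (conn_out Hv Hc).
Qed.

Lemma component_sep_cap X c :
  ~ X c -> sep_cap (fun v => ~ conn X c v, fun v => X v \/ conn X c v) = X.
Proof.
  intros Hc; apply set_ext; intros v; unfold sep_cap; simpl; split; [tauto|].
  intros Hv; split; [|auto]; intros H; exact (conn_out H Hc Hv).
Qed.

(* P being principal, it lives in a single component of G - X; cutting off that component
   distinguishes P from every Q that some separation with separator X distinguishes from P. *)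
Lemma dist_component P Q X :
  PP P -> PP Q -> sep_dist P Q X ->
  exists c, ~ X c /\
    distinguishes (fun v => ~ conn X c v, fun v => X v \/ conn X c v) P Q.
Proof.
  intros HP HQ [s [Hs [Hr HX]]].
  assert (HkX : has_size X k) by (rewrite <- HX; exact (dist_size HP HQ Hs Hr)).
  destruct (profile_of HP) as [_ Hpr].
  (* Principality for all members of [P] with separator [X] at once puts a single vertex [c] beyond
     all of them. *)
  destruct (Hpr (fun t => P t /\ sep_cap t = X) X) as [c Hc]; [tauto| |].
  { intros t [_ <-] v; reflexivity. }
  assert (HXc : ~ X c).
  { rewrite <- HX; intros [H _]; apply (Hc s); auto. }
  exists c; split; [exact HXc|].
  set (t := (fun v => ~ conn X c v, fun v => X v \/ conn X c v) : sep (vert G)).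
  assert (Ht : is_sep G t) by (apply component_sep_is_sep, HXc).
  assert (Hcap : sep_cap t = X) by (apply component_sep_cap, HXc).
  assert (Hkt : has_size (sep_cap t) k) by (rewrite Hcap; exact HkX).
  left; split.
  - destruct (orient HP Ht Hkt (le_n k)) as [H|H]; [exact H|].
    destruct (Hc (sep_rev t)) as [H1 _]; [rewrite sep_cap_rev; auto|].
    destruct H1; apply conn_refl.
  (* The component of [c] together with [X] lies in the second side of [s], so by (P1) [Q] cannot
     contain [t] besides the reverse of [s]. *)
  - destruct (orient HQ Ht Hkt (le_n k)) as [H|H]; [exfalso|exact H].
    destruct (profile_of HQ) as [[[_ [HP1 _]] _] _].
    pose proof (member_sep HP Hs) as Hsep.
    assert (Hside : forall v, conn X c v -> ~ fst s v).
    { intros v Hv; rewrite <- HX in Hv; apply (sep_conn Hsep Hv), Hc; auto. }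
    apply (HP1 (sep_rev s) (sep_rev t)); [|exact Hr|rewrite sep_rev_rev; exact H].
    destruct Hsep as [Hcov _]; split; simpl.
    + intros v [Hv|Hv].
      * rewrite <- HX in Hv; apply Hv.
      * destruct (Hcov v); [destruct (Hside v); auto|auto].
    + intros v Hv Hcv; exact (Hside v Hcv Hv).
Qed.

Lemma chosen_tree_distinguishes P Q :
  PP P -> PP Q -> k_distinguishable G k P Q ->
  td_distinguishes (structure_tree (chosen PP)) P Q.
Proof.
  intros HP HQ [s [_ [_ Hd]]].
  assert (H0 : sep_dist P Q (sep_cap s)).
  { destruct Hd as [[H1 H2]|[H1 H2]]; [|apply sep_dist_sym]; exists s; auto. }
  destruct (exists_chosen HP HQ H0) as [X [HX HXc]].
  destruct (dist_component HP HQ HX) as [c [Hc Hdist]].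
  destruct (@structure_tree_edge G (chosen PP)) with (X := X) (c := c) as [a [b [Hab Hsep]]];
    auto using chosen_antichain, chosen_inhabited, chosen_separators_fin,
      relevant_full, chosen_relevant.
  - intros Y HY Z HZ; apply chosen_unsplit; auto.
  - intros Y HY; exact (has_size_fin (relevant_size (chosen_relevant HY))).
  - exists a, b; split; [exact Hab|rewrite Hsep; exact Hdist].
Qed.

Lemma chosen_tree_balanced : k_balanced (structure_tree (chosen PP)) k.
Proof. apply structure_tree_balanced; auto using relevant_size, chosen_relevant. Qed.

End Profiles.

(** * Invariance under isomorphisms *)

(** With [g] the inverse of a bijection [f], this is the image of [X] under [f]. *)
Definition push (V W : Type) (g : W -> V) (X : V -> Prop) : W -> Prop := fun w => X (g w).

Definition push_sep (V W : Type) (g : W -> V) (s : sep V) : sep W :=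
  (push g (fst s), push g (snd s)).

(** Carrying both inverse maps makes the notion symmetric: a transport lemma is proved in one
    direction and reversed by [iso_pair_sym]. *)
Definition iso_pair (G G' : graph) (f : vert G -> vert G') (g : vert G' -> vert G)
    (PP : profset G) (PP' : profset G') : Prop :=
  (forall v, g (f v) = v) /\ (forall w, f (g w) = w) /\
  (forall u v, adj G u v -> adj G' (f u) (f v)) /\
  (forall u v, adj G' u v -> adj G (g u) (g v)) /\
  (forall P, PP P -> PP' (fun s => P (push_sep f s))) /\
  (forall P', PP' P' -> PP (fun s => P' (push_sep g s))).

Lemma iso_pair_sym G G' f g (PP : profset G) (PP' : profset G') :
  iso_pair f g PP PP' -> iso_pair g f PP' PP.
Proof. unfold iso_pair; tauto. Qed.

Lemma push_push (V W : Type) (f : V -> W) (g : W -> V) X :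
  (forall v, g (f v) = v) -> push f (push g X) = X.
Proof. intros H; apply set_ext; intros v; unfold push; rewrite H; reflexivity. Qed.

Lemma push_sep_push (V W : Type) (f : V -> W) (g : W -> V) s :
  (forall v, g (f v) = v) -> push_sep f (push_sep g s) = s.
Proof.
  intros H; destruct s; unfold push_sep; simpl; f_equal; apply push_push; exact H.
Qed.

Lemma iso_pair_of_maps G G' f (PP : profset G) (PP' : profset G') :
  is_iso G G' f -> maps_profset f PP PP' -> exists g, iso_pair f g PP PP'.
Proof.
  intros [[g [Hgf Hfg]] Hadj] Hmaps; exists g.
  split; [exact Hgf|split; [exact Hfg|split; [intros u v; apply Hadj|split]]].
  - intros u v H; apply Hadj; rewrite !Hfg; exact H.
  - split.
    + intros P HP; apply Hmaps; exists P; split; [exact HP|].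
      intros s; apply iff_refl.
    + intros P' HP'; apply Hmaps in HP'; destruct HP' as [P [HP H]].
      replace (fun s => P' (push_sep g s)) with P; [exact HP|].
      apply set_ext; intros s; rewrite H.
      change (P s <-> P (push_sep f (push_sep g s))).
      rewrite push_sep_push by exact Hgf; reflexivity.
Qed.

Section Transport.
Variables G G' : graph.
Variables (f : vert G -> vert G') (g : vert G' -> vert G).
Variables (PP : profset G) (PP' : profset G').
Hypothesis Hiso : iso_pair f g PP PP'.

Lemma conn_push Z u v : conn Z u v -> conn (push g Z) (f u) (f v).
Proof.
  destruct Hiso as [Hgf [_ [Hadj _]]].
  induction 1 as [u v [Huv [Hu Hv]]|u|u v w _ IH1 _ IH2].
  - apply conn_adj; unfold push; rewrite ?Hgf; auto.
  - apply conn_refl.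
  - eapply conn_trans; eauto.
Qed.

Lemma sep_dist_push P Q X :
  sep_dist P Q X ->
  sep_dist (fun s => P (push_sep f s)) (fun s => Q (push_sep f s)) (push g X).
Proof.
  destruct Hiso as [Hgf _].
  intros [s [Hs [Hr <-]]]; exists (push_sep g s).
  split; [rewrite push_sep_push by exact Hgf; exact Hs|].
  split; [|reflexivity].
  change (Q (push_sep f (push_sep g (sep_rev s)))).
  rewrite push_sep_push by exact Hgf; exact Hr.
Qed.

Lemma relevant_push X : relevant PP X -> relevant PP' (push g X).
Proof.
  intros [P [Q [HP [HQ H]]]].
  exists (fun s => P (push_sep f s)), (fun s => Q (push_sep f s)).
  destruct Hiso as [_ [_ [_ [_ [HPP _]]]]]; auto using sep_dist_push.
Qed.

End Transport.

Lemma conn_push_iff G G' f g (PP : profset G) (PP' : profset G') Z u v :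
  iso_pair f g PP PP' -> conn (push g Z) (f u) (f v) <-> conn Z u v.
Proof.
  intros Hiso; split; [|apply (conn_push Hiso)].
  intros H; apply (conn_push (iso_pair_sym Hiso)) in H; revert H.
  destruct Hiso as [Hgf _]; rewrite push_push, !Hgf by exact Hgf; auto.
Qed.

Lemma separates_push_iff G G' f g (PP : profset G) (PP' : profset G') Z u v :
  iso_pair f g PP PP' -> separates (push g Z) (f u) (f v) <-> separates Z u v.
Proof.
  intros Hiso; unfold separates; rewrite (conn_push_iff _ _ _ Hiso).
  destruct Hiso as [Hgf _]; unfold push; rewrite !Hgf; reflexivity.
Qed.

Lemma crossers_push G G' f g (PP : profset G) (PP' : profset G') X Z :
  iso_pair f g PP PP' -> crossers PP X Z -> crossers PP' (push g X) (push g Z).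
Proof.
  intros Hiso [HZ [u [v [Hu [Hv Hsep]]]]]; split; [eapply relevant_push; eauto|].
  exists (f u), (f v); rewrite (separates_push_iff _ _ _ Hiso).
  destruct Hiso as [Hgf _]; unfold push; rewrite !Hgf; auto.
Qed.

Lemma crossers_size_push G G' f g (PP : profset G) (PP' : profset G') X n :
  iso_pair f g PP PP' -> has_size (crossers PP X) n ->
  has_size (crossers PP' (push g X)) n.
Proof.
  intros Hiso [l [Hl [Hn HX]]].
  pose proof Hiso as [Hgf [Hfg _]].
  exists (map (push g) l); split; [|split].
  - apply FinFun.Injective_map_NoDup; [|exact Hl].
    intros A B H; rewrite <- (push_push (f := f) (g := g) A Hgf), H; apply push_push, Hgf.
  - rewrite length_map; exact Hn.
  - intros Z; rewrite in_map_iff; split.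
    + intros H; apply (crossers_push (iso_pair_sym Hiso)) in H.
      rewrite push_push in H by exact Hgf.
      exists (push f Z); split; [apply push_push, Hfg|apply HX, H].
    + intros [Y [<- HY]]; apply (crossers_push Hiso), HX, HY.
Qed.

Lemma chosen_push G G' f g (PP : profset G) (PP' : profset G') X :
  iso_pair f g PP PP' -> chosen PP X -> chosen PP' (push g X).
Proof.
  intros Hiso [P [Q [HP [HQ [HX Hmin]]]]].
  pose proof Hiso as [Hgf [Hfg [_ [_ [HPP _]]]]].
  exists (fun s => P (push_sep f s)), (fun s => Q (push_sep f s)).
  split; [auto|split; [auto|split; [exact (sep_dist_push Hiso HX)|]]].
  intros Y HY m n Hm Hn.
  (* A competitor [Y] in [G'] is pulled back to [G], where minimality of [X] applies. *)
  apply (Hmin (push f Y)).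
  - apply (sep_dist_push (iso_pair_sym Hiso)) in HY.
    assert (H : forall R : sep (vert G) -> Prop,
      (fun s => R (push_sep f (push_sep g s))) = R).
    { intros R; apply set_ext; intros s; rewrite push_sep_push by exact Hgf; reflexivity. }
    rewrite !H in HY; exact HY.
  - apply (crossers_size_push (iso_pair_sym Hiso)) in Hm.
    rewrite push_push in Hm by exact Hgf; exact Hm.
  - exact (crossers_size_push (iso_pair_sym Hiso) Hn).
Qed.

Lemma chosen_push_iff G G' f g (PP : profset G) (PP' : profset G') X :
  iso_pair f g PP PP' -> chosen PP' (push g X) <-> chosen PP X.
Proof.
  intros Hiso; split; [|apply (chosen_push Hiso)].
  intros H; apply (chosen_push (iso_pair_sym Hiso)) in H.
  rewrite push_push in H by apply Hiso; exact H.
Qed.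

Lemma region_push G G' f g (PP : profset G) (PP' : profset G') X c :
  iso_pair f g PP PP' ->
  push g (region (chosen PP) X c) = region (chosen PP') (push g X) (f c).
Proof.
  intros Hiso; pose proof Hiso as [Hgf [Hfg _]].
  apply set_ext; intros w; unfold region, push at 1.
  rewrite <- (conn_push_iff X c (g w) Hiso), Hfg.
  split; intros [H1 H2]; (split; [exact H1|]).
  - intros Z x HZ Hx Hsep; apply (H2 (push f Z) (g x)).
    + apply (chosen_push (iso_pair_sym Hiso) HZ).
    + exact Hx.
    + apply (separates_push_iff Z x w (iso_pair_sym Hiso)), Hsep.
  - intros Z x HZ Hx Hsep; apply (H2 (push g Z) (f x)).
    + apply (chosen_push Hiso HZ).
    + unfold push; rewrite Hgf; exact Hx.
    + rewrite <- (Hfg w); apply (separates_push_iff Z x (g w) Hiso), Hsep.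
Qed.

Lemma node_push G G' f g (PP : profset G) (PP' : profset G') U :
  iso_pair f g PP PP' -> is_node (chosen PP) U -> is_node (chosen PP') (push g U).
Proof.
  intros Hiso [HU|[X [c [HX [Hc ->]]]]]; [left; apply (chosen_push Hiso HU)|right].
  exists (push g X), (f c); split; [apply (chosen_push Hiso HX)|split].
  - unfold push; destruct Hiso as [Hgf _]; rewrite Hgf; exact Hc.
  - apply (region_push X c Hiso).
Qed.

Lemma hangs_on_push G G' f g (PP : profset G) (PP' : profset G') X U :
  iso_pair f g PP PP' ->
  hangs_on (chosen PP) X U <-> hangs_on (chosen PP') (push g X) (push g U).
Proof.
  intros Hiso; unfold hangs_on.
  rewrite (chosen_push_iff X Hiso), (chosen_push_iff U Hiso).
  destruct Hiso as [Hgf [Hfg _]]; unfold push.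
  split; intros [H1 [H2 H3]]; (split; [exact H1|split; [exact H2|]]); [auto|].
  intros v; specialize (H3 (f v)); rewrite Hgf in H3; exact H3.
Qed.

Definition push_node G G' f g (PP : profset G) (PP' : profset G')
    (Hiso : iso_pair f g PP PP') (a : tnode (structure_tree (chosen PP))) :
    tnode (structure_tree (chosen PP')) :=
  exist _ (push g (proj1_sig a)) (node_push Hiso (proj2_sig a)).

Lemma structure_tree_push G G' f g (PP : profset G) (PP' : profset G') :
  iso_pair f g PP PP' ->
  maps_td f (structure_tree (chosen PP)) (structure_tree (chosen PP')).
Proof.
  intros Hiso; pose proof Hiso as [Hgf [Hfg _]].
  exists (push_node Hiso); split; [|split].
  - exists (push_node (iso_pair_sym Hiso)); split; intros a; apply node_eq; simpl;
      apply push_push; assumption.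
  - intros a b; simpl.
    rewrite !(hangs_on_push _ _ Hiso); reflexivity.
  - intros a v; simpl; unfold push; rewrite Hgf; reflexivity.
Qed.

Theorem theorem5p1 :
  exists F : forall G : graph, profset G -> tdec G,
    (forall (G : graph) (PP : profset G) (k : nat), thm_hyp PP k ->
       is_td (F G PP) /\
       (forall P P', PP P -> PP P' -> is_robust G P -> is_robust G P' ->
          k_distinguishable G k P P' -> td_distinguishes (F G PP) P P') /\
       k_balanced (F G PP) k) /\
    (forall (G G' : graph) (PP : profset G) (PP' : profset G') (k : nat)
            (f : vert G -> vert G'),
       thm_hyp PP k -> is_iso G G' f -> maps_profset f PP PP' ->
       maps_td f (F G PP) (F G' PP')).
Proof.
  (* No choice enters [chosen] or [structure_tree], so one formula serves all graphs and canonicity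
     is transport along isomorphisms. *)
  exists (fun G PP => structure_tree (chosen PP)); split.
  - intros G PP k HPP; split; [exact (chosen_tree_is_td HPP)|split].
    + intros P P' HP HP' _ _; exact (chosen_tree_distinguishes HPP HP HP').
    + exact (chosen_tree_balanced HPP).
  - intros G G' PP PP' k f _ Hf Hmaps.
    destruct (iso_pair_of_maps Hf Hmaps) as [g Hiso].
    exact (structure_tree_push Hiso).
Qed.
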